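(* Let $\mathcal{C}$ be a class of $N$ subsets of $\{1,\ldots,n\}$, each of cardinality $K\ge1$, and let $\mathcal{A}\subset\mathcal{C}$ be any $\frac{\sqrt K}{2}$-cover of $\mathcal{C}$. For any $\delta\in(0,1)$, the type I error of the optimal test $f^*$ satisfies $$\mathbb{P}_0\{f^*(\mathbf{X})=1\}\ \le\ \delta$$ whenever $$\mu\ \ge\ \frac2K\,\mathbb{E}_0\max_{S\in\mathcal{A}}X_S+\sqrt{\frac{32\log(2/\delta)}{K}}.$$
   Context: Setting: $\mathcal{C}=\{S_1,\ldots,S_N\}$ is a class of $N\ge1$ distinct subsets of $\{1,\ldots,n\}$, all of the same cardinality $K$, and $\mu>0$. Under $\mathbb{P}_0$ (with expectation $\mathbb{E}_0$), the components of the random vector $\mathbf{X}=(X_1,\ldots,X_n)$ are independent standard normal. Write $X_S=\sum_{i\in S}X_i$ and, for $\mathbf{x}\in\mathbb{R}^n$, $x_S=\sum_{i\in S}x_i$. The optimal test (for testing $\mathbb{P}_0$ against the uniform mixture over $S\in\mathcal{C}$ of the laws under which the coordinates are independent with $X_i\sim\mathcal{N}(\mu,1)$ for $i\in S$ and $X_i\sim\mathcal{N}(0,1)$ for $i\notin S$) is $$f^*(\mathbf{x})=\mathbf{1}_{\{L(\mathbf{x})>1\}},\qquad L(\mathbf{x})=\frac1N\sum_{S\in\mathcal{C}}e^{\mu x_S-K\mu^2/2}.$$ The class $\mathcal{C}$ is equipped with the metric $d(S,T)=\sqrt{\mathbb{E}_0(X_S-X_T)^2}=\sqrt{|S\triangle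 T|}$, where $S\triangle T$ is the symmetric difference. A subset $\mathcal{A}\subset\mathcal{C}$ is a $t$-cover of $\mathcal{C}$ if for every $S\in\mathcal{C}$ there is $T\in\mathcal{A}$ with $d(S,T)\le t$. *)

(* Defs.v *)
From HB Require Import structures.
From mathcomp Require Import all_boot all_order all_algebra.
From mathcomp Require Import all_classical all_reals all_analysis.

Set Implicit Arguments.
Unset Strict Implicit.
Unset Printing Implicit Defensive.

Import Order.TTheory GRing.Theory Num.Theory.
Import numFieldNormedType.Exports.

Local Open Scope classical_set_scope.
Local Open Scope ring_scope.

Section RandomVector.
Context d (Omega : measurableType d) (R : realType) (P : probability Omega R).
Context (n : nat) (X : 'I_n -> {RV P >-> R}).

Definition mutually_independent : Prop :=
  forall (J : {set 'I_n}) (B : 'I_n -> set R),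
    (forall i, measurable (B i)) ->
    P [set w | forall i, i \in J -> B i (X i w)] =
    (\prod_(i in J) P (X i @^-1` B i))%E.

Definition iid_standard_normal : Prop :=
  mutually_independent /\
  forall i (B : set R), measurable B ->
    distribution P (X i) B = normal_prob 0 1 B.

Definition random_vector (w : Omega) : 'rV[R]_n := \row_i X i w.

End RandomVector.

Section OptimalTest.
Context (R : realType) (n : nat).
Implicit Types (S T : {set 'I_n}) (A C : {set {set 'I_n}}) (x : 'rV[R]_n).

Definition subset_sum S x : R := \sum_(i in S) x 0 i.

Definition likelihood_ratio C (K : nat) (mu : R) x : R :=
  #|C|%:R^-1 *
  \sum_(S in C) expR (mu * subset_sum S x - K%:R * mu ^+ 2 / 2).

Definition optimal_test C (K : nat) (mu : R) : 'rV[R]_n -> R :=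
  \1_[set x | 1 < likelihood_ratio C K mu x].

(* The maximum is taken in [\bar R] so that -oo can serve as the neutral
   element; it is a real number as soon as [A] is nonempty. *)
Definition max_subset_sum A x : R :=
  fine (\big[maxe/-oo%E]_(S in A) (subset_sum S x)%:E).

End OptimalTest.

Section Metric.
Context d (Omega : measurableType d) (R : realType) (P : probability Omega R).
Context (n : nat) (X : 'I_n -> {RV P >-> R}).
Implicit Types (S T : {set 'I_n}) (A C : {set {set 'I_n}}).

(* When the components of [X] are independent standard normal, this is the
   square root of the cardinality of the symmetric difference of S and T. *)
Definition L2_dist S T : R :=
  Num.sqrt (fine 'E_P[fun w => (subset_sum S (random_vector X w)
                              - subset_sum T (random_vector X w)) ^+ 2]).

Definition is_cover (t : R) A C : Prop :=
  A \subset C /\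
  forall S, S \in C -> exists2 T, T \in A & L2_dist S T <= t.

End Metric.

(* Main.v *)
(** Let [F] be the maximum of the [X_S] over the cover and put
    [s = sqrt (2 K ln (2 / delta))], [t = 7/8 K mu - s].  The type I error is
    at most [P (F >= t) + E (L; F < t)], and each term is at most [delta / 2].

    Second term: if [T] in the cover is within [sqrt K / 2] of [S], then
    [|S :&: T| >= 7/8 K], so under the law tilted by [S] the variable [X_T]
    has mean at least [7/8 K mu], and [X_T < t] is an [s]-deviation.  In the
    proof this is the exponential moment of [mu X_S - l X_T].

    First term: [t >= 7/4 E F + 5/2 s], so a concentration inequality that is
    not sharp suffices.  It comes from a discrete Maurey-Pisier argument.  For
    independent [x], [y], move from [x] to [y] by three rotations of 30
    degrees of the plane they span.  By convexity
    [exp (l (F x - F y))] is at most the average of the three terms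
    [exp (3 l (F x_j - F x_(j+1)))], which have the same law by rotation
    invariance.  If [X_T] attains the maximum at [x], then with
    [c = sqrt 3 / 2]
      [F x - F (c x + y / 2) <= (1 - c) F x - X_T y / 2],
    whose exponential moment in [y] is explicit; what remains is the
    exponential moment of [l F] to the power [3 (1 - c) < 3/7], which is
    absorbed by the left-hand side. *)
Require Import Defs.
From HB Require Import structures.
From mathcomp Require Import all_boot all_order all_algebra.
From mathcomp Require Import all_classical all_reals all_analysis measurable_realfun.
From mathcomp Require Import ring lra.

Set Implicit Arguments.
Unset Strict Implicit.
Unset Printing Implicit Defensive.

Import Order.TTheory GRing.Theory Num.Theory.
Import numFieldNormedType.Exports.

Local Open Scope classical_set_scope.
Local Open Scope ring_scope.

(** * Affine substitutions in Lebesgue integrals on the line *)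

Section AffineSubstitution.
Context {R : realType}.
Local Notation leb := (@lebesgue_measure R).
Local Open Scope ereal_scope.

(** Uniqueness of Lebesgue measure reduces this to half-open intervals. A negative [a] moves the
    closed end to the other side, which leaves the length unchanged. *)
Lemma lebesgue_measure_affine (a b : R) (A : set R) :
  a != 0%R -> measurable A ->
  (`|a|%:E * leb ((fun x => a * x + b)%R @^-1` A) = leb A).
Proof.
move=> a0 mA.
have mf : measurable_fun setT
    (fun x : measurableTypeR R => (a * x + b)%R : measurableTypeR R).
  by apply: measurable_funD => //; exact: measurable_funM.
pose f := (fun x : measurableTypeR R => (a * x + b)%R : measurableTypeR R).
apply/esym/(@lebesgue_measure_unique R
  (mscale (NngNum (normr_ge0 a)) (pushforward leb f))) => //=.
move=> _ [[x y]] _ <-.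
rewrite /mscale/= /pushforward.
have [agt|alt] := ltP 0%R a.
  have -> : f @^-1` `]x, y]%classic = `]((x - b) / a)%R, ((y - b) / a)%R]%classic.
    apply/seteqP; split => z;
    by rewrite /f/= !in_itv/= ltr_pdivrMr// ler_pdivlMr// ltrBlDr lerBrDr (mulrC a).
  rewrite !lebesgue_measure_itv/= !lte_fin ltr_pM2r ?invr_gt0// ltrD2r.
  case: ifPn => [xy|_]; last by rewrite mule0.
  rewrite gtr0_norm// -!EFinD -EFinM; congr _%:E.
  by field; rewrite gt_eqF.
have {}alt : (a < 0)%R by rewrite lt_neqAle a0.
have -> : f @^-1` `]x, y]%classic = `[((y - b) / a)%R, ((x - b) / a)%R[%classic.
  apply/seteqP; split => z;
  by rewrite /f/= !in_itv/= ler_ndivrMr// ltr_ndivlMr// ltrBlDr lerBrDr (mulrC a) andbC.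
rewrite !lebesgue_measure_itv/= !lte_fin ltr_nM2r ?invr_lt0// ltrD2r.
case: ifPn => [xy|_]; last by rewrite mule0.
rewrite ltr0_norm// -!EFinD -EFinM; congr _%:E.
by field; rewrite lt_eqF.
Qed.

Lemma ge0_integral_affine (a b : R) (h : R -> \bar R) : a != 0%R ->
  measurable_fun setT h -> (forall x, 0 <= h x) ->
  `|a|%:E * \int[leb]_x h (a * x + b)%R = \int[leb]_x h x.
Proof.
move=> a0 mh h0.
have mf : measurable_fun setT
    (fun x : measurableTypeR R => (a * x + b)%R : measurableTypeR R).
  by apply: measurable_funD => //; exact: measurable_funM.
pose f := (fun x : measurableTypeR R => (a * x + b)%R : measurableTypeR R).
rewrite -[X in _ * X](ge0_integral_pushforward mf leb (D := setT))//.
rewrite -(ge0_integral_mscale _ measurableT (NngNum (normr_ge0 a)))//.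
apply: eq_measure_integral => A mA _.
exact: (lebesgue_measure_affine b a0 mA).
Qed.

End AffineSubstitution.

(** * The standard normal law on the line: moments and rotation invariance in the plane *)

Section StandardNormal.
Context {R : realType}.
Local Notation leb := (@lebesgue_measure R).
Local Notation gauss := (@normal_prob R 0 1).
Local Notation phi := (@normal_pdf R 0 1).
Local Open Scope ereal_scope.

Lemma normal_pdf01E (x : R) :
  phi x = (normal_peak 1 * expR (- x ^+ 2 / 2))%R.
Proof. by rewrite normal_pdfE ?oner_neq0// /normal_fun subr0 expr1n. Qed.

Lemma normal_pdf01N (x : R) : phi (- x)%R = phi x.
Proof. by rewrite !normal_pdf01E sqrrN. Qed.

(** The Radon-Nikodym derivative of the normal law has the same integral as [phi] over every
    measurable set, so the two agree almost everywhere. *)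
Lemma ge0_integral_normal_prob (h : R -> \bar R) :
  measurable_fun setT h -> (forall x, 0 <= h x) ->
  \int[gauss]_x h x = \int[leb]_x (h x * (phi x)%:E).
Proof.
move=> mh h0.
have dom := @normal_prob_dominates R 0%R 1%R.
have mphi : measurable_fun setT (fun x : R => (phi x)%:E).
  by apply/measurable_EFinP; exact: measurable_normal_pdf.
rewrite -(Radon_Nikodym_SigmaFinite.change_of_variables dom)//.
have ifn := Radon_Nikodym_SigmaFinite.f_integrable dom.
apply: ae_eq_integral => //.
- by apply: emeasurable_funM => //; exact: (measurable_int _ ifn).
- exact: emeasurable_funM.
- apply: ae_eqe_mul2l; apply: integral_ae_eq => //.
  by move=> E _ mE; rewrite -(Radon_Nikodym_SigmaFinite.f_integral dom).
Qed.

Lemma ge0_integral_normal_probN (h : R -> \bar R) :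
  measurable_fun setT h -> (forall x, 0 <= h x) ->
  \int[gauss]_x h (- x)%R = \int[gauss]_x h x.
Proof.
move=> mh h0.
have mphi : measurable_fun setT (fun x : R => (phi x)%:E).
  by apply/measurable_EFinP; exact: measurable_normal_pdf.
rewrite !ge0_integral_normal_prob//; last exact: measurableT_comp.
rewrite -(@ge0_integral_affine _ (-1) 0 (fun x => h x * (phi x)%:E))//; last 2 first.
- exact: emeasurable_funM.
- by move=> x; rewrite mule_ge0// lee_fin normal_pdf_ge0.
rewrite normrN1 mul1e; apply: eq_integral => x _.
by rewrite addr0 mulN1r normal_pdf01N.
Qed.

(** Completing the square turns the integrand into a multiple of the density translated by [a]. *)
Lemma integral_normal_expR (a : R) :
  \int[gauss]_x (expR (a * x))%:E = (expR (a ^+ 2 / 2))%:E.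
Proof.
have mexp : measurable_fun setT (fun x : R => (expR (a * x))%:E).
  by apply/measurable_EFinP; exact: measurableT_comp.
have mphi : measurable_fun setT (fun x : R => (phi x)%:E).
  by apply/measurable_EFinP; exact: measurable_normal_pdf.
rewrite ge0_integral_normal_prob//.
transitivity (\int[leb]_x ((expR (a ^+ 2 / 2))%:E * (phi (1 * x + - a)%R)%:E)).
  apply: eq_integral => x _; rewrite -!EFinM !normal_pdf01E; congr _%:E.
  rewrite mulrCA [RHS]mulrCA -!expRD; congr (_ * expR _)%R.
  by field.
rewrite ge0_integralZl//; last 2 first.
- apply: (measurableT_comp mphi (g := fun x : R => (1 * x + - a)%R)).
  by apply: measurable_funD => //; exact: measurable_funM.
- by move=> x _; rewrite lee_fin normal_pdf_ge0.
have := @ge0_integral_affine _ 1 (- a) (fun x => (phi x)%:E) (oner_neq0 _) mphi.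
rewrite normr1 mul1e => ->; last by move=> x; rewrite lee_fin normal_pdf_ge0.
by rewrite integral_normal_pdf mule1.
Qed.

(* Integrating [1 - b x^2 / 2 <= exp (- b x^2 / 2)] with [1 + b = s^2]. *)
Lemma integral_normal_sqr_ge (s : R) : (1 < s)%R ->
  ((s ^- 2)%:E <= \int[gauss]_x (x ^+ 2)%:E).
Proof.
move=> s1; have s0 : (0 < s)%R by lra.
set b := (s ^+ 2 - 1)%R; have b0 : (0 < b)%R by rewrite subr_gt0 exprn_egt1.
have mphi : measurable_fun setT (fun x : R => (phi x)%:E).
  by apply/measurable_EFinP; exact: measurable_normal_pdf.
have msqr : measurable_fun setT (fun x : R => (x ^+ 2)%R).
  exact: measurable_funX.
have mexp : measurable_fun setT (fun x : R => (expR (- (b / 2) * x ^+ 2))%:E).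
  apply/measurable_EFinP; apply: measurableT_comp => //.
  exact: measurable_funM.
have Eexp : \int[gauss]_x (expR (- (b / 2) * x ^+ 2))%:E = (s^-1)%:E.
  rewrite ge0_integral_normal_prob//.
  transitivity (\int[leb]_x (phi (s * x + 0)%R)%:E).
    apply: eq_integral => x _; rewrite -!EFinM !normal_pdf01E; congr _%:E.
    rewrite mulrCA -!expRD; congr (_ * expR _)%R.
    by rewrite /b; field.
  have := @ge0_integral_affine _ s 0 (fun x => (phi x)%:E) (lt0r_neq0 s0) mphi.
  rewrite integral_normal_pdf gtr0_norm// => /(_ (fun x => _)) H.
  have {}H := H (fun x => normal_pdf_ge0 0 1 x).
  have : s^-1%:E * (s%:E * \int[leb]_x (phi (s * x + 0))%:E) = s^-1%:E.
    by rewrite H mule1.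
  by rewrite muleA -EFinM mulVf ?gt_eqF// mul1e.
have v0 : 0 <= \int[gauss]_x (x ^+ 2)%:E.
  by apply: integral_ge0 => x _; rewrite lee_fin sqr_ge0.
have : 1 <= (s^-1)%:E + (b / 2)%:E * \int[gauss]_x (x ^+ 2)%:E.
  rewrite -Eexp -ge0_integralZl//; last 3 first.
  - exact/measurable_EFinP.
  - by move=> x _; rewrite lee_fin sqr_ge0.
  - by rewrite lee_fin divr_ge0// ltW.
  have m2 : measurable_fun setT (fun x : R => (b / 2)%:E * (x ^+ 2)%:E).
    by apply/measurable_EFinP; exact: measurable_funM.
  rewrite -ge0_integralD//; last first.
    by move=> x _; rewrite lee_fin mulr_ge0 ?sqr_ge0 ?divr_ge0// ltW.
  rewrite -(@probability_setT _ _ _ gauss) -[X in X <= _]mul1e -integral_cst//.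
  apply: ge0_le_integral => //.
  - exact: emeasurable_funD.
  - move=> x _; rewrite -EFinM -EFinD lee_fin mulNr.
    by rewrite -lerBlDr; exact: expR_ge1Dx.
case: (\int[gauss]_x _) v0 => [v||]//=; last by move=> _ _; exact: leey.
rewrite !lee_fin /b => v0 H.
have -> : (s ^- 2 = s^-1 * s^-1)%R by rewrite expr2 invfM.
have : (s * s^-1 = 1)%R by rewrite mulfV// gt_eqF.
have : (0 < s^-1)%R by rewrite invr_gt0.
move: (s^-1)%R H => t H t0 st.
(* Since [1 - t = t * (s - 1)], the factor [s - 1] cancels. The last step uses
   [2 * t / (s + 1) = 2 * t ^+ 2 / (1 + t)], which exceeds [t ^+ 2] because [t < 1]. *)
have : (2 * t <= (s + 1) * v)%R.
  rewrite -(ler_pM2l (_ : 0 < s - 1)%R) ?subr_gt0//.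
  nra.
nra.
Qed.

(** This is the limit of the previous bound as [s] tends to 1. A second moment [v < 1] is refuted by
    [s = 2 / (1 + v)], because [((1 + v) / 2) ^+ 2 > v]. *)
Lemma integral_normal_sqr_ge1 : 1 <= \int[gauss]_x (x ^+ 2)%:E.
Proof.
have v0 : 0 <= \int[gauss]_x (x ^+ 2)%:E.
  by apply: integral_ge0 => x _; rewrite lee_fin sqr_ge0.
have := integral_normal_sqr_ge.
case: (\int[gauss]_x _) v0 => [v||]//=; last by move=> _ _; exact: leey.
rewrite !lee_fin => v0 H; rewrite leNgt; apply/negP => v1.
have /H : (1 < 2 / (1 + v))%R by rewrite ltr_pdivlMr; lra.
rewrite lee_fin -exprVn invf_div; nra.
Qed.

(** The rotation is performed as two one-dimensional substitutions separated by an exchange of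
    integrals: [u = c x + s y] at fixed [x], then [x = c u - s v] at fixed [u]. [G] is the integrand
    in the intermediate coordinates [(x, u)], and [s != 0] makes both substitutions invertible. *)
Lemma integral_normal_rotation (c s : R) (h : R * R -> \bar R) :
  (c ^+ 2 + s ^+ 2 = 1)%R -> s != 0%R ->
  measurable_fun setT h -> (forall z, 0 <= h z) ->
  \int[gauss]_x \int[gauss]_y h (c * x + s * y, c * y - s * x)%R =
  \int[gauss]_x \int[gauss]_y h (x, y).
Proof.
move=> cs s0 mh h0.
pose G (z : R * R) : \bar R := (phi z.1)%:E *
  (h (z.2, (c * z.2 - z.1) / s)%R * (phi ((z.2 - c * z.1) / s))%:E).
have m1 : measurable_fun setT (fun z : R * R => z.1) by exact: measurable_fst.
have m2 : measurable_fun setT (fun z : R * R => z.2) by exact: measurable_snd.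
have mphi := measurable_normal_pdf (0 : R) 1.
have mG : measurable_fun setT G.
  apply: emeasurable_funM.
    by apply/measurable_EFinP; exact: measurableT_comp.
  apply: emeasurable_funM.
    apply: (measurableT_comp mh); apply/measurable_fun_pairP; split => //=.
    apply: measurable_funM => //; apply: measurable_funB => //.
    exact: measurable_funM.
  apply/measurable_EFinP; apply: measurableT_comp => //.
  apply: measurable_funM => //; apply: measurable_funB => //.
  exact: measurable_funM.
have G0 z : 0 <= G z.
  by rewrite /G !mule_ge0// lee_fin normal_pdf_ge0.
pose k (z : R * R) := h (c * z.1 + s * z.2, c * z.2 - s * z.1)%R.
have mk : measurable_fun setT k.
  apply: (measurableT_comp mh); apply/measurable_fun_pairP; split => //=.
    by apply: measurable_funD; apply: measurable_funM.
  by apply: measurable_funB; apply: measurable_funM.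
have k0 z : 0 <= k z by exact: h0.
have sn0 : `|s|%R != 0%R by rewrite normr_eq0.
have inner x : \int[gauss]_y k (x, y) * (phi x)%:E =
    (`|s|^-1)%:E * \int[leb]_u G (x, u).
  have mkx : measurable_fun setT (fun y => k (x, y)).
    exact: (measurableT_comp mk (pair1_measurable x)).
  have mGx : measurable_fun setT (fun y => G (x, y)).
    exact: (measurableT_comp mG (pair1_measurable x)).
  rewrite ge0_integral_normal_prob// -ge0_integralZr//; last 3 first.
  - apply: emeasurable_funM => //.
    by apply/measurable_EFinP.
  - by move=> y _; rewrite mule_ge0// lee_fin normal_pdf_ge0.
  - by rewrite lee_fin normal_pdf_ge0.
  rewrite -(@ge0_integral_affine _ s (c * x) (fun u => G (x, u)))//.
  rewrite muleA -EFinM mulVf// mul1e.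
  apply: eq_integral => y _; rewrite /G /k/= muleC; congr (_ * (h _ * _)).
    congr pair; first by rewrite addrC.
    have : (c ^+ 2 = 1 - s ^+ 2)%R by rewrite -cs addrK.
    by move=> c2; field: c2.
  by congr (phi _)%:E; field.
have outer u : \int[leb]_x G (x, u) =
    `|s|%:E * (\int[gauss]_v h (u, v) * (phi u)%:E).
  have mhu : measurable_fun setT (fun v => h (u, v)).
    exact: (measurableT_comp mh (pair1_measurable u)).
  have mGu : measurable_fun setT (fun x => G (x, u)).
    exact: (measurableT_comp mG (pair2_measurable u)).
  rewrite ge0_integral_normal_prob// -ge0_integralZr//; last 3 first.
  - apply: emeasurable_funM => //.
    by apply/measurable_EFinP.
  - by move=> y _; rewrite mule_ge0// lee_fin normal_pdf_ge0.
  - by rewrite lee_fin normal_pdf_ge0.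
  have ns0 : (- s != 0)%R by rewrite oppr_eq0.
  have E := @ge0_integral_affine _ (- s) (c * u) (fun x => G (x, u)) ns0 mGu
    (fun x => G0 (x, u)).
  apply: (eq_trans (esym E)); rewrite normrN; apply: (congr1 (mule _)).
  have c2 : (c ^+ 2 = 1 - s ^+ 2)%R by rewrite -cs addrK.
  apply: eq_integral => v _; rewrite /G /=.
  have -> : ((c * u - (- s * v + c * u)) / s = v)%R by field.
  have -> : ((u - c * (- s * v + c * u)) / s = s * u + c * v)%R by field: c2.
  rewrite muleCA -muleA; congr (_ * _); rewrite -!EFinM; congr _%:E.
  rewrite !normal_pdf01E mulrACA [RHS]mulrACA -!expRD; congr (_ * expR _)%R.
  by field: c2.
rewrite [LHS]ge0_integral_normal_prob//; last 2 first.
- exact: (measurable_fun_fubini_tonelli_F (m2 := gauss) k).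
- by move=> x; exact: integral_ge0.
transitivity (\int[leb]_x ((`|s|^-1)%:E * \int[leb]_u G (x, u))).
  by apply: eq_integral => x _; exact: inner.
rewrite ge0_integralZl//; last 2 first.
- exact: (measurable_fun_fubini_tonelli_F (m2 := leb) G).
- by move=> x _; exact: integral_ge0.
rewrite (fubini_tonelli (m1 := leb) (m2 := leb) G)//.
under eq_integral do rewrite outer.
have mF : measurable_fun setT (fun u : R => \int[gauss]_v h (u, v)).
  exact: (measurable_fun_fubini_tonelli_F (m2 := gauss) h).
rewrite ge0_integralZl//; last 2 first.
- apply: emeasurable_funM => //.
  by apply/measurable_EFinP.
- by move=> x _; rewrite mule_ge0 ?integral_ge0// lee_fin normal_pdf_ge0.
rewrite muleA -EFinM mulVf// mul1e [RHS]ge0_integral_normal_prob//.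
by move=> x; exact: integral_ge0.
Qed.

End StandardNormal.

(** * Integrals against probability measures, products and images *)

Lemma integral_probability_cst d (T : measurableType d) (R : realType)
  (P : probability T R) (r : \bar R) : (\int[P]_x r = r)%E.
Proof. by rewrite integral_cst//= probability_setT mule1. Qed.

Lemma ge0_integral_prod_mul d1 d2 (T1 : measurableType d1) (T2 : measurableType d2)
    (R : realType) (P1 : probability T1 R) (P2 : probability T2 R)
    (f : T1 -> \bar R) (g : T2 -> \bar R) :
  measurable_fun setT f -> measurable_fun setT g ->
  (forall x, 0 <= f x)%E -> (forall y, 0 <= g y)%E ->
  (\int[P1 \x P2]_z (f z.1 * g z.2) = \int[P1]_x f x * \int[P2]_y g y)%E.
Proof.
move=> mf mg f0 g0.
have mfg : measurable_fun setT (fun z : T1 * T2 => f z.1 * g z.2)%E.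
  apply: emeasurable_funM.
  - exact: (measurableT_comp mf measurable_fst).
  - exact: (measurableT_comp mg measurable_snd).
rewrite fubini_tonelli1//; last by move=> z; exact: mule_ge0.
under eq_integral => x _ do rewrite /fubini_F /= ge0_integralZl//.
by rewrite ge0_integralZr// integral_ge0.
Qed.

Section ImageProbability.
Context d d' (T : measurableType d) (T' : measurableType d') (R : realType).
Variables (P : probability T R) (f : T -> T').
Hypothesis mf : measurable_fun setT f.

Let f_mixin := isMeasurableFun.Build _ _ _ _ f mf.
Let f_pack : {mfun T >-> T'} := HB.pack f f_mixin.

(** [distribution] expects a packed measurable function; this form takes a bare function with a
    proof of measurability. *)
Definition image_probability : probability T' R := distribution P f_pack.

Lemma image_probabilityE A : image_probability A = P (f @^-1` A).
Proof. by []. Qed.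

Lemma ge0_integral_image_probability (h : T' -> \bar R) :
  measurable_fun setT h -> (forall y, 0 <= h y)%E ->
  (\int[image_probability]_y h y = \int[P]_x h (f x))%E.
Proof. by move=> mh h0; rewrite ge0_integral_distribution. Qed.

End ImageProbability.

(** * Finite powers of a probability measure, as laws on tuples *)

Section TuplePower.
Context d (T : measurableType d) (R : realType) (nu : probability T R).
Local Open Scope ereal_scope.

Definition tuple_cons n (z : T * n.-tuple T) : n.+1.-tuple T :=
  [tuple of z.1 :: z.2].

Lemma measurable_tuple_cons n : measurable_fun setT (@tuple_cons n).
Proof. exact: measurable_cons. Qed.

(** The product measure is built one coordinate at a time, so that integrals over tuples can be
    computed by induction on [n]. *)
Fixpoint tuple_power n : probability (n.-tuple T) R :=
  match n with
  | 0 => @dirac _ _ [tuple] R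
  | m.+1 => image_probability (nu \x tuple_power m) (@measurable_tuple_cons m)
  end.

Definition rectangle n (B : 'I_n -> set T) : set (n.-tuple T) :=
  [set t | forall i, B i (tnth t i)].

Lemma rectangle_consE n (B : 'I_n.+1 -> set T) :
  @tuple_cons n @^-1` rectangle B =
  B ord0 `*` rectangle (fun i => B (lift ord0 i)).
Proof.
apply/seteqP; split => [[x t] /= Bxt|[x t] [/= Bx Bt] i].
  split => [|i] /=; first by have := Bxt ord0; rewrite tnth0.
  by have := Bxt (lift ord0 i); rewrite tnthS.
by case: (unliftP ord0 i) => [j|] ->; rewrite ?tnthS ?tnth0.
Qed.

Lemma measurable_rectangle n (B : 'I_n -> set T) :
  (forall i, measurable (B i)) -> measurable (rectangle B).
Proof.
move=> mB.
have -> : rectangle B = \bigcap_(i in [set: 'I_n]) ((fun t => tnth t i) @^-1` B i).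
  by apply/seteqP; split => [t Bt i _|t Bt i]; [exact: Bt|exact: Bt].
apply: fin_bigcap_measurable => [|i _]; first exact: finite_finset.
rewrite -[X in measurable X]setTI.
exact: (measurable_tnth i).
Qed.

Lemma tuple_power_rectangle n (B : 'I_n -> set T) :
  (forall i, measurable (B i)) ->
  tuple_power n (rectangle B) = \prod_(i < n) nu (B i).
Proof.
elim: n B => [|n IH] B mB.
  rewrite big_ord0 /= diracE mem_set//; by case.
rewrite big_ord_recl -IH// -product_measure1E//; last exact: measurable_rectangle.
by rewrite -rectangle_consE.
Qed.

Lemma integral_tuple_powerS n (f : n.+1.-tuple T -> \bar R) :
  measurable_fun setT f -> (forall t, 0 <= f t) ->
  \int[tuple_power n.+1]_t f t =
  \int[nu]_x \int[tuple_power n]_t f (tuple_cons (x, t)).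
Proof.
move=> mf f0 /=; rewrite ge0_integral_image_probability//.
rewrite fubini_tonelli1//.
exact: (measurableT_comp mf (@measurable_tuple_cons n)).
Qed.

(** Boxes with sides in an intersection-stable generator [G] form an intersection-stable family
    generating the tuple sigma-algebra. Leaving [G] free allows sides that are themselves
    rectangles, as needed for tuples of pairs. *)
Lemma tuple_measure_unique (G : set (set T)) n
    (m1 m2 : probability (n.-tuple T) R) :
  measurable = <<s G >> -> setI_closed G -> G setT ->
  (forall B : 'I_n -> set T, (forall i, G (B i)) ->
    m1 (rectangle B) = m2 (rectangle B)) ->
  forall A, measurable A -> m1 A = m2 A.
Proof.
move=> mG GI GT m12.
have mGi B : G B -> measurable B by rewrite mG => GB; exact: sub_sigma_algebra.
pose RG : set (set (n.-tuple T)) :=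
  [set @rectangle n B | B in [set B | forall i, G (B i)]].
have rectT : @rectangle n (fun=> setT) = setT by apply/seteqP; split.
apply: (measure_unique RG (fun=> setT)) => //.
- apply/seteqP; split.
    apply: smallest_sub; first exact: smallest_sigma_algebra.
    move=> A; rewrite -bigcup_seq => -[i _] /= [B mB <-{A}].
    move: B mB; rewrite mG => B.
    (* The sets whose [i]-th cylinder lies in [<<s RG >>] form a sigma-algebra, so it suffices to
       treat members of [G]. Their cylinders are boxes with every other side equal to [setT]. *)
    apply: (smallest_sub (C := sigma_algebra setT)
      (X := image_set_system setT (fun t : n.-tuple T => tnth t i) <<s RG >>)).
      by apply: sigma_algebra_image; exact: smallest_sigma_algebra.
    move=> {}B GB; apply: sub_sigma_algebra.
    exists (fun j => if j == i then B else setT).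
      by move=> j /=; case: ifP.
    apply/seteqP; split => t /=.
      by move=> /(_ i); rewrite eqxx.
    by move=> [_ Bt] j; case: eqP => // ->.
  apply: smallest_sub; first exact: sigma_algebra_measurable.
  by move=> _ [B GB <-]; apply: measurable_rectangle => i; exact/mGi/GB.
- move=> _ _ [B1 GB1 <-] [B2 GB2 <-]; exists (fun i => B1 i `&` B2 i).
    by move=> i; exact: GI.
  apply/seteqP; split => [t Bt|t [B1t B2t] i]; last by split.
  by split => i; have [] := Bt i.
- by move=> _; exists (fun=> setT).
- by rewrite bigcup_const//; exists 0%N.
- by move=> _ [B GB <-]; exact: m12.
- by move=> _; apply: (le_lt_trans (probability_le1 m1 measurableT)); exact: ltry.
Qed.

End TuplePower.

(** * Coordinatewise operations on powers of a measure *)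

Section TuplePowerMap.
Context {R : realType}.
Local Open Scope ereal_scope.

Definition tuple_zip d (T : measurableType d) n (z : n.-tuple T * n.-tuple T) :
  n.-tuple (T * T) := [tuple (tnth z.1 i, tnth z.2 i) | i < n].

Lemma measurable_tuple_zip d (T : measurableType d) n :
  measurable_fun setT (@tuple_zip d T n).
Proof.
apply/measurable_fun_tnthP => i.
rewrite (_ : _ \o _ = fun z => (tnth z.1 i, tnth z.2 i)); last first.
  by apply/funext => z /=; rewrite tnth_mktuple.
apply/measurable_fun_pairP; split => /=.
- exact: (measurableT_comp (measurable_tnth i)).
- exact: (measurableT_comp (measurable_tnth i)).
Qed.

(** Two independent vectors become one vector of independent pairs, on which a joint rotation acts
    coordinate by coordinate. *)
Lemma tuple_power_zip d (T : measurableType d) (nu : probability T R) n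
    (E : set (n.-tuple (T * T))) : measurable E ->
  (tuple_power nu n \x tuple_power nu n) (@tuple_zip _ T n @^-1` E) =
  tuple_power (nu \x nu) n E.
Proof.
pose G : set (set (T * T)) :=
  [set A `*` B | A in measurable & B in measurable].
apply: (@tuple_measure_unique _ _ _ G n
  (image_probability (tuple_power nu n \x tuple_power nu n)
    (@measurable_tuple_zip d T n))
  (tuple_power (nu \x nu) n)).
- exact: measurable_prod_measurableType.
- move=> _ _ [A1 mA1 [B1 mB1 <-]] [A2 mA2 [B2 mB2 <-]].
  exists (A1 `&` A2); first exact: measurableI.
  by exists (B1 `&` B2); [exact: measurableI|rewrite setXI].
- by exists setT => //; exists setT => //; rewrite setXTT.
- move=> B GB.
  have /choice[A /= HA] i : exists A : set T * set T,
      [/\ measurable A.1, measurable A.2 & B i = A.1 `*` A.2].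
    by have [A1 mA1 [A2 mA2 <-]] := GB i; exists (A1, A2).
  have mB i : measurable (B i).
    by have [mA1 mA2 ->] := HA i; exact: measurableX.
  rewrite tuple_power_rectangle//.
  have -> : @tuple_zip _ T n @^-1` rectangle B =
      rectangle (fun i => (A i).1) `*` rectangle (fun i => (A i).2).
    apply/seteqP; split => [[x y] /= Bxy|[x y] [/= Ax Ay] i].
      by split => i; have := Bxy i; have [_ _ ->] := HA i;
        rewrite tnth_mktuple => -[].
    by rewrite tnth_mktuple; have [_ _ ->] := HA i; split; [exact: Ax|exact: Ay].
  have mA1 i : measurable (A i).1 by have [] := HA i.
  have mA2 i : measurable (A i).2 by have [] := HA i.
  rewrite product_measure1E; [|exact: measurable_rectangle..].
  transitivity (\prod_(i < n) nu (A i).1 * \prod_(i < n) nu (A i).2).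
    by congr (_ * _); exact: tuple_power_rectangle.
  rewrite -big_split/=; apply: eq_bigr => i _.
  by have [_ _ ->] := HA i; rewrite product_measure1E.
Qed.

Lemma tuple_power_map d (T : measurableType d) (nu : probability T R)
    (f : T -> T) n (E : set (n.-tuple T)) : measurable_fun setT f ->
  (forall A, measurable A -> nu (f @^-1` A) = nu A) -> measurable E ->
  tuple_power nu n ((fun t => [tuple f (tnth t i) | i < n]) @^-1` E) =
  tuple_power nu n E.
Proof.
move=> mf nuf.
pose F (t : n.-tuple T) := [tuple f (tnth t i) | i < n].
have mF : measurable_fun setT F.
  apply/measurable_fun_tnthP => i.
  rewrite (_ : _ \o _ = fun t => f (tnth t i)); last first.
    by apply/funext => z /=; rewrite tnth_mktuple.
  exact: (measurableT_comp mf (measurable_tnth i)).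
apply: (@tuple_measure_unique _ _ _ measurable n
  (image_probability (tuple_power nu n) mF) (tuple_power nu n)).
- by rewrite sigma_algebra_id//; exact: sigma_algebra_measurable.
- by move=> A B mA mB; exact: measurableI.
- exact: measurableT.
- move=> B mB; rewrite tuple_power_rectangle//.
  rewrite image_probabilityE.
  have -> : F @^-1` rectangle B = rectangle (fun i => f @^-1` B i).
    apply/seteqP; split => t Bt i; have := Bt i; rewrite /= tnth_mktuple//.
  rewrite tuple_power_rectangle.
    by apply: eq_bigr => i _; exact: nuf.
  by move=> i; rewrite -[X in measurable X]setTI; exact: mf.
Qed.

End TuplePowerMap.

(** * Standard Gaussian vectors and their linear forms *)

Section GaussianVector.
Context {R : realType}.
Local Open Scope ereal_scope.

Let mid : measurable_fun setT (fun x : measurableTypeR R => x : R).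
Proof. by move=> _ A mA; rewrite setTI. Qed.

(* [normal_prob 0 1] lives on [measurableTypeR R], whose display differs from
   the one of the measurable structure carried by [R]. *)
Definition std_gauss : probability R R :=
  image_probability (normal_prob 0 1) mid.

Lemma integral_std_gauss (h : R -> \bar R) :
  measurable_fun setT h -> (forall x, 0 <= h x) ->
  \int[std_gauss]_x h x = \int[normal_prob 0 1]_x h x.
Proof. exact: ge0_integral_image_probability. Qed.

Definition gauss_vect n : probability (n.-tuple R) R := tuple_power std_gauss n.

Lemma integral_gauss_vectS n (f : n.+1.-tuple R -> \bar R) :
  measurable_fun setT f -> (forall t, 0 <= f t) ->
  \int[gauss_vect n.+1]_t f t =
  \int[std_gauss]_x \int[gauss_vect n]_t f (tuple_cons (x, t)).
Proof. exact: integral_tuple_powerS. Qed.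

Section RandomVectorLaw.
Context d (Omega : measurableType d) (P : probability Omega R) (n : nat).
Variable X : 'I_n -> {RV P >-> R}.
Hypothesis iidX : iid_standard_normal X.

Definition rv_tuple (w : Omega) : n.-tuple R := [tuple X i w | i < n].

Lemma measurable_rv_tuple : measurable_fun setT rv_tuple.
Proof.
apply/measurable_fun_tnthP => i.
by rewrite (_ : _ \o _ = X i)//; apply/funext => w /=; rewrite tnth_mktuple.
Qed.

(** Independence over the full index set gives the product formula on boxes, and boxes determine the
    law. *)
Lemma rv_tuple_law A : measurable A -> P (rv_tuple @^-1` A) = gauss_vect n A.
Proof.
have [indX lawX] := iidX.
apply: (@tuple_measure_unique _ R R measurable n
  (image_probability P measurable_rv_tuple)).
- by rewrite sigma_algebra_id//; exact: sigma_algebra_measurable.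
- by move=> B1 B2; exact: measurableI.
- exact: measurableT.
- move=> B mB; rewrite tuple_power_rectangle// image_probabilityE.
  have -> : rv_tuple @^-1` rectangle B =
      [set w | forall i, i \in [set: 'I_n]%SET -> B i (X i w)].
    apply/seteqP; split => w /= Bw i.
      by move=> _; have := Bw i; rewrite tnth_mktuple.
    by rewrite tnth_mktuple; apply: Bw; rewrite inE.
  rewrite indX//; apply: eq_big => [i|i _]; first by rewrite inE.
  exact: lawX.
Qed.

Lemma ge0_integral_rv_tuple (h : n.-tuple R -> \bar R) :
  measurable_fun setT h -> (forall t, 0 <= h t) ->
  \int[P]_w h (rv_tuple w) = \int[gauss_vect n]_t h t.
Proof.
move=> mh h0.
rewrite -(ge0_integral_image_probability _ measurable_rv_tuple)//.
by apply: eq_measure_integral => A mA _; exact: rv_tuple_law.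
Qed.

(** The signed version serves the expectation of the maximum, which can take negative values. *)
Lemma integral_rv_tuple (h : n.-tuple R -> \bar R) :
  measurable_fun setT h ->
  \int[P]_w h (rv_tuple w) = \int[gauss_vect n]_t h t.
Proof.
move=> mh; rewrite integralE [RHS]integralE; congr (_ - _).
- rewrite -(ge0_integral_rv_tuple (h := h^\+))//; last exact: measurable_funepos.
  by apply: eq_integral => w _; rewrite -[LHS]/((h \o rv_tuple)^\+ w) funepos_comp.
- rewrite -(ge0_integral_rv_tuple (h := h^\-))//; last exact: measurable_funeneg.
  by apply: eq_integral => w _; rewrite -[LHS]/((h \o rv_tuple)^\- w) funeneg_comp.
Qed.

End RandomVectorLaw.

Definition lin_form n (a : 'I_n -> R) (t : n.-tuple R) : R :=
  (\sum_(i < n) a i * tnth t i)%R.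

Lemma measurable_lin_form n (a : 'I_n -> R) : measurable_fun setT (lin_form a).
Proof.
apply: measurable_sum => i; apply: measurable_funM => //.
exact: measurable_tnth.
Qed.

Lemma lin_form_cons n (a : 'I_n.+1 -> R) x (t : n.-tuple R) :
  lin_form a (tuple_cons (x, t)) =
  (a ord0 * x + lin_form (fun i : 'I_n => a (lift ord0 i)) t)%R.
Proof.
rewrite /lin_form big_ord_recl tnth0; congr (_ + _)%R.
by apply: eq_bigr => i _; rewrite tnthS.
Qed.

Lemma integral_gauss_vect_expR n (a : 'I_n -> R) :
  \int[gauss_vect n]_t (expR (lin_form a t))%:E =
  (expR ((\sum_(i < n) a i ^+ 2) / 2))%:E.
Proof.
have mexp m (b : 'I_m -> R) :
    measurable_fun setT (fun t : m.-tuple R => (expR (lin_form b t))%:E).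
  apply/measurable_EFinP; apply: measurableT_comp => //.
  exact: measurable_lin_form.
elim: n a => [|n IH] a.
  under eq_integral do rewrite /lin_form big_ord0.
  by rewrite big_ord0 mul0r integral_probability_cst.
rewrite integral_gauss_vectS//.
transitivity (\int[std_gauss]_x ((expR (a ord0 * x))%:E *
    (expR ((\sum_(i < n) a (lift ord0 i) ^+ 2) / 2))%:E)).
  apply: eq_integral => x _.
  under eq_integral do rewrite lin_form_cons expRD EFinM.
  rewrite ge0_integralZl//; last exact: mexp.
  by rewrite IH.
rewrite ge0_integralZr//; last first.
  by apply/measurable_EFinP; exact: measurableT_comp.
rewrite integral_std_gauss//; last first.
  by apply/measurable_EFinP; exact: measurableT_comp.
by rewrite integral_normal_expR -EFinM -expRD big_ord_recl mulrDl.
Qed.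

(** The shift [b] absorbs the coordinates already fixed, which makes the induction go through. A
    lower bound is enough: the cover condition bounds a distance from above, and this transfers the
    bound to the sum of squares. *)
Lemma integral_gauss_vect_sqr_ge n (a : 'I_n -> R) (b : R) :
  (b ^+ 2 + \sum_(i < n) a i ^+ 2)%:E <=
  \int[gauss_vect n]_t ((b + lin_form a t) ^+ 2)%:E.
Proof.
have msqr m (e : 'I_m -> R) (f : R) :
    measurable_fun setT (fun t : m.-tuple R => ((f + lin_form e t) ^+ 2)%:E).
  apply/measurable_EFinP; apply: measurable_funX; apply: measurable_funD => //.
  exact: measurable_lin_form.
elim: n a b => [|n IH] a b.
  under eq_integral do rewrite /lin_form big_ord0.
  by rewrite big_ord0 integral_probability_cst !addr0.
rewrite integral_gauss_vectS//; last first.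
  by move=> t; rewrite lee_fin sqr_ge0.
pose c : R := (\sum_(i < n) a (lift ord0 i) ^+ 2)%R.
have c0 : (0 <= c)%R by apply: sumr_ge0 => i _; exact: sqr_ge0.
have m2 (u v : R) : measurable_fun setT (fun x : R => ((u + v * x) ^+ 2 + c)%:E).
  apply/measurable_EFinP; apply: measurable_funD => //; apply: measurable_funX.
  by apply: measurable_funD => //; exact: measurable_funM.
have p2 (u v x : R) : (0 <= (u + v * x) ^+ 2 + c)%R by rewrite addr_ge0// sqr_ge0.
apply: (@le_trans _ _ (\int[std_gauss]_x ((b + a ord0 * x) ^+ 2 + c)%:E)); last first.
  apply: ge0_le_integral => //.
  - by move=> x _; rewrite lee_fin.
  - apply: (measurable_fun_fubini_tonelli_F (m2 := gauss_vect n)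
      (fun z => ((b + lin_form a (tuple_cons z)) ^+ 2)%:E)).
      exact: (measurableT_comp (msqr _ a b) (@measurable_tuple_cons _ _ n)).
    by move=> z; rewrite lee_fin sqr_ge0.
  - move=> x _; under eq_integral do rewrite lin_form_cons addrA.
    exact: IH.
(* Averaging over [x] and [- x] removes the cross term. *)
have sym : \int[std_gauss]_x ((b + a ord0 * x) ^+ 2 + c)%:E =
    \int[std_gauss]_x ((a ord0 ^+ 2)%:E * (x ^+ 2)%:E + (b ^+ 2 + c)%:E).
  set I1 := LHS.
  have I1N : \int[std_gauss]_x ((b + - a ord0 * x) ^+ 2 + c)%:E = I1.
    rewrite /I1 !integral_std_gauss//; [|by move=> x; rewrite lee_fin..].
    rewrite -ge0_integral_normal_probN//; last by move=> x; rewrite lee_fin.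
    by apply: eq_integral => x _; rewrite mulrNN.
  have h0 : 0 <= (2^-1 : R)%:E by rewrite lee_fin invr_ge0.
  have -> : I1 = (2^-1)%:E * I1 + (2^-1)%:E * I1.
    by rewrite -ge0_muleDl// -EFinD (_ : _ + _ = 1)%R ?mul1e//; lra.
  rewrite -{2}I1N /I1 -!ge0_integralZl//; [|by move=> x _; rewrite lee_fin..].
  rewrite -ge0_integralD//.
  - apply: eq_integral => x _; rewrite -!EFinM -!EFinD; congr _%:E.
    by field.
  - by move=> x _; rewrite -EFinM lee_fin mulr_ge0// invr_ge0.
  - exact: emeasurable_funM.
  - by move=> x _; rewrite -EFinM lee_fin mulr_ge0// invr_ge0.
  - exact: emeasurable_funM.
have msq : measurable_fun setT (fun x : R => (x ^+ 2)%:E).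
  by apply/measurable_EFinP; exact: measurable_funX.
rewrite sym ge0_integralD//; last 3 first.
- by move=> x _; rewrite -EFinM lee_fin mulr_ge0// sqr_ge0.
- exact: emeasurable_funM.
- by move=> x _; rewrite lee_fin addr_ge0// sqr_ge0.
rewrite integral_probability_cst ge0_integralZl//; last 2 first.
- by move=> x _; rewrite lee_fin sqr_ge0.
- by rewrite lee_fin sqr_ge0.
rewrite big_ord_recl -/c addrCA EFinD; apply: leeD => //.
rewrite -[X in X <= _]mule1; apply: lee_pmul => //.
  by rewrite lee_fin sqr_ge0.
rewrite integral_std_gauss//; first exact: integral_normal_sqr_ge1.
by move=> x; rewrite lee_fin sqr_ge0.
Qed.

End GaussianVector.

(** * Rotation invariance of a pair of independent Gaussian vectors *)

Section GaussianRotation.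
Context {R : realType}.
Local Open Scope ereal_scope.
Local Notation gauss := (@std_gauss R).
Local Notation gaussn n := (@gauss_vect R n).

Definition plane_rot (c s : R) (z : R * R) : R * R :=
  (c * z.1 + s * z.2, c * z.2 - s * z.1)%R.

Lemma measurable_plane_rot c s : measurable_fun setT (plane_rot c s).
Proof.
apply/measurable_fun_pairP; split => /=.
- by apply: measurable_funD; apply: measurable_funM.
- by apply: measurable_funB; apply: measurable_funM.
Qed.

Lemma std_gauss_plane_rot (c s : R) (A : set (R * R)) :
  (c ^+ 2 + s ^+ 2 = 1)%R -> s != 0%R -> measurable A ->
  (gauss \x gauss) (plane_rot c s @^-1` A) = (gauss \x gauss) A.
Proof.
move=> cs s0 mA.
have mrA : measurable (plane_rot c s @^-1` A).
  by rewrite -[X in measurable X]setTI; exact: measurable_plane_rot.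
have E (h : R * R -> \bar R) : measurable_fun setT h -> (forall z, 0 <= h z) ->
    \int[gauss \x gauss]_z h z =
    \int[normal_prob 0 1]_x \int[normal_prob 0 1]_y h (x, y).
  move=> mh h0; rewrite fubini_tonelli1// integral_std_gauss.
  - apply: eq_integral => x _; rewrite /fubini_F integral_std_gauss//.
    exact: (measurableT_comp mh (pair1_measurable x)).
  - exact: (measurable_fun_fubini_tonelli_F (m2 := gauss) h).
  - by move=> x; exact: integral_ge0.
have m1 B : measurable B -> measurable_fun setT (fun z : R * R => (\1_B z)%:E : \bar R).
  by move=> mB; apply/measurable_EFinP; exact: measurable_indic.
have EI B : measurable B -> (gauss \x gauss) B =
    \int[normal_prob 0 1]_x \int[normal_prob 0 1]_y (\1_B (x, y))%:E.
  move=> mB; rewrite -(E (fun z => (\1_B z)%:E) (m1 _ mB))//.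
  by have := integral_indic (gauss \x gauss) measurableT mB; rewrite setIT => ->.
rewrite (EI _ mrA) (EI _ mA).
exact: (integral_normal_rotation cs s0 (m1 _ mA)).
Qed.

Definition tuple_rot (c s : R) n (z : n.-tuple R * n.-tuple R) :
    n.-tuple R * n.-tuple R :=
  ([tuple c * tnth z.1 i + s * tnth z.2 i | i < n]%R,
   [tuple c * tnth z.2 i - s * tnth z.1 i | i < n]%R).

Lemma measurable_tuple_rot c s n : measurable_fun setT (@tuple_rot c s n).
Proof.
have m1 i : measurable_fun setT (fun z : n.-tuple R * n.-tuple R => tnth z.1 i).
  exact: (measurableT_comp (measurable_tnth i)).
have m2 i : measurable_fun setT (fun z : n.-tuple R * n.-tuple R => tnth z.2 i).
  exact: (measurableT_comp (measurable_tnth i)).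
apply/measurable_fun_pairP; split; apply/measurable_fun_tnthP => i.
- rewrite (_ : _ \o _ = fun z => (c * tnth z.1 i + s * tnth z.2 i)%R); last first.
    by apply/funext => z /=; rewrite tnth_mktuple.
  by apply: measurable_funD; apply: measurable_funM.
- rewrite (_ : _ \o _ = fun z => (c * tnth z.2 i - s * tnth z.1 i)%R); last first.
    by apply/funext => z /=; rewrite tnth_mktuple.
  by apply: measurable_funB; apply: measurable_funM.
Qed.

(** Zipping the two vectors turns the rotation into [plane_rot] applied to each of [n] independent
    pairs, and each pair has a rotation-invariant law. *)
Lemma integral_gauss_vect_rot (c s : R) n (h : n.-tuple R * n.-tuple R -> \bar R) :
  (c ^+ 2 + s ^+ 2 = 1)%R -> s != 0%R ->
  measurable_fun setT h -> (forall z, 0 <= h z) ->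
  \int[gaussn n \x gaussn n]_z h (tuple_rot c s z) =
  \int[gaussn n \x gaussn n]_z h z.
Proof.
move=> cs s0 mh h0.
apply: (eq_trans (esym (ge0_integral_image_probability
  (gaussn n \x gaussn n) (@measurable_tuple_rot c s n) mh h0))).
apply: eq_measure_integral => A mA _.
pose unzip (t : n.-tuple (R * R)) : n.-tuple R * n.-tuple R :=
  ([tuple (tnth t i).1 | i < n], [tuple (tnth t i).2 | i < n]).
have munzip : measurable_fun setT unzip.
  apply/measurable_fun_pairP; split; apply/measurable_fun_tnthP => i.
  - rewrite (_ : _ \o _ = fun t => (tnth t i).1); last first.
      by apply/funext => z /=; rewrite tnth_mktuple.
    exact: (measurableT_comp measurable_fst (measurable_tnth i)).
  - rewrite (_ : _ \o _ = fun t => (tnth t i).2); last first.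
      by apply/funext => z /=; rewrite tnth_mktuple.
    exact: (measurableT_comp measurable_snd (measurable_tnth i)).
pose E := unzip @^-1` A.
have mE : measurable E.
  by rewrite -[X in measurable X]setTI; exact: munzip.
pose F (t : n.-tuple (R * R)) := [tuple plane_rot c s (tnth t i) | i < n].
have mF : measurable_fun setT F.
  apply/measurable_fun_tnthP => i.
  rewrite (_ : _ \o _ = fun t => plane_rot c s (tnth t i)); last first.
    by apply/funext => z /=; rewrite tnth_mktuple.
  exact: (measurableT_comp (measurable_plane_rot c s) (measurable_tnth i)).
have mFE : measurable (F @^-1` E).
  by rewrite -[X in measurable X]setTI; exact: mF.
have unzipK z : unzip (tuple_zip z) = z.
  by case: z => x y; congr pair; apply: eq_from_tnth => i; rewrite !tnth_mktuple.
have unzipF z : unzip (F (tuple_zip z)) = tuple_rot c s z.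
  by congr pair; apply: eq_from_tnth => i; rewrite !tnth_mktuple.
have AE : A = @tuple_zip _ R n @^-1` E.
  by apply/predeqP => z; rewrite /E /preimage /mkset unzipK.
have rAE : @tuple_rot c s n @^-1` A = @tuple_zip _ R n @^-1` (F @^-1` E).
  by apply/predeqP => z; rewrite /E /preimage /mkset unzipF.
have mroti : forall B, measurable B -> (gauss \x gauss) (plane_rot c s @^-1` B) =
  (gauss \x gauss) B by move=> B; exact: std_gauss_plane_rot.
apply: (eq_trans (congr1 (gaussn n \x gaussn n) rAE)).
apply: (eq_trans (tuple_power_zip gauss mFE)).
have H := tuple_power_map (nu := (gauss \x gauss : probability (R * R)%type R))
  (measurable_plane_rot c s) mroti mE.
apply: (eq_trans H).
apply: (eq_trans (esym (tuple_power_zip gauss mE))).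
exact: (congr1 (gaussn n \x gaussn n) (esym AE)).
Qed.

End GaussianRotation.

(** * Convexity inequalities for the exponential *)

Section ExponentialInequalities.
Context {R : realType}.
Implicit Types x y a p q r : R.

Lemma expR_tangent x y : expR y * (1 + (x - y)) <= expR x.
Proof.
by rewrite -[x in leRHS](subrKC y) expRD ler_wpM2l ?expR_ge0// expR_ge1Dx.
Qed.

(** Jensen's inequality for three points: [m] is the mean of [3 * p], [3 * q], [3 * r], so the
    linear terms of the tangents at [m] cancel in the average. *)
Lemma expR_mean3 p q r :
  expR (p + q + r) <= 3^-1 * (expR (3 * p) + expR (3 * q) + expR (3 * r)).
Proof.
set m := p + q + r.
have := expR_tangent (3 * p) m; have := expR_tangent (3 * q) m.
have := expR_tangent (3 * r) m; have : m = p + q + r by [].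
move: (expR_ge0 m); nra.
Qed.

(** The tangent at [a * x] is evaluated at [x] and at 0, with weights [a] and [1 - a]. *)
Lemma expR_convex a x : 0 <= a -> a <= 1 -> expR (a * x) <= a * expR x + (1 - a).
Proof.
move=> a0 a1.
have := expR_tangent x (a * x); have := expR_tangent 0 (a * x).
rewrite expR0; move: (expR_ge0 (a * x)); nra.
Qed.

Lemma normr_le_expR x : `|x| <= expR x + expR (- x).
Proof.
have := expR_ge1Dx x; have := expR_ge1Dx (- x).
have := expR_ge0 x; have := expR_ge0 (- x).
by case: (ger0P x) => x0 A B C D; lra.
Qed.

(** Including [+oo] lets three equal integrals be averaged before they are known to be finite. *)
Lemma ereal_third (u : \bar R) : (0 <= u -> u = (3^-1)%:E * (u + u + u))%E.
Proof.
case: u => [r||]//= _; last by rewrite gt0_muley// lte_fin invr_gt0.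
by rewrite -EFinM; congr EFin; field.
Qed.

Lemma ge0_integral_mean3 d (T : measurableType d) (P : {measure set T -> \bar R})
    (h h1 h2 : T -> \bar R) :
  measurable_fun setT h -> measurable_fun setT h1 -> measurable_fun setT h2 ->
  (forall z, 0 <= h z)%E -> (forall z, 0 <= h1 z)%E -> (forall z, 0 <= h2 z)%E ->
  (\int[P]_z h1 z = \int[P]_z h z)%E -> (\int[P]_z h2 z = \int[P]_z h z)%E ->
  (\int[P]_z ((3^-1)%:E * (h z + h1 z + h2 z)) = \int[P]_z h z)%E.
Proof.
move=> mh mh1 mh2 p p1 p2 E1 E2.
have mh01 := emeasurable_funD mh mh1.
rewrite ge0_integralZl//; last 2 first.
- exact: emeasurable_funD.
- by move=> z _; rewrite !adde_ge0.
rewrite ge0_integralD//; last by move=> z _; rewrite adde_ge0.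
by rewrite ge0_integralD// E1 E2 -ereal_third// integral_ge0.
Qed.

End ExponentialInequalities.

(** * Exponential moments of a maximum of Gaussian linear forms *)

Section MaxLinearForms.
Context {R : realType} (n : nat) (J : finType) (a : J -> 'I_n -> R) (v : R).
Variable F : n.-tuple R -> R.
Hypothesis mF : measurable_fun setT F.
Hypothesis a_le : forall j, \sum_(i < n) a j i ^+ 2 <= v.
Hypothesis F_ub : forall t j, lin_form (a j) t <= F t.
Hypothesis F_att : forall t, exists j, F t = lin_form (a j) t.
Local Notation gaussn := (@gauss_vect R n).
Local Open Scope ereal_scope.

Let mexpF (l : R) : measurable_fun setT (fun t => (expR (l * F t))%:E : \bar R).
Proof.
apply/measurable_EFinP; apply: measurableT_comp => //.
exact: measurable_funM.
Qed.

Let j0 : J.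
Proof. by have [j _] := cid (F_att [tuple 0%R | i < n]); exact: j. Qed.

Lemma lin_formZ (l : R) (b : 'I_n -> R) (t : n.-tuple R) :
  lin_form (fun i => l * b i)%R t = (l * lin_form b t)%R.
Proof. by rewrite /lin_form mulr_sumr; apply: eq_bigr => i _; rewrite mulrA. Qed.

Lemma integral_expR_lin_form_le (l : R) j :
  \int[gaussn]_t (expR (l * lin_form (a j) t))%:E <= (expR (l ^+ 2 * v / 2))%:E.
Proof.
under eq_integral do rewrite -lin_formZ.
rewrite integral_gauss_vect_expR lee_fin ler_expR ler_pM2r//.
under eq_bigr do rewrite exprMn.
by rewrite -mulr_sumr ler_wpM2l// sqr_ge0.
Qed.

Let mexplin (l : R) j :
  measurable_fun setT (fun t => (expR (l * lin_form (a j) t))%:E : \bar R).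
Proof.
apply/measurable_EFinP; apply: measurableT_comp => //.
by apply: measurable_funM => //; exact: measurable_lin_form.
Qed.

(** The value at the maximising form is one of the terms of the sum over all forms. The bound is
    crude but holds for [l] of either sign. *)
Lemma integral_expR_max_lty (l : R) : \int[gaussn]_t (expR (l * F t))%:E < +oo.
Proof.
apply: (@le_lt_trans _ _ (\sum_(j : J) \int[gaussn]_t (expR (l * lin_form (a j) t))%:E)).
  rewrite -ge0_integral_sum//.
  apply: ge0_le_integral => //.
  - by apply: emeasurable_sum => j; exact: mexplin.
  - move=> t _; have [j ->] := F_att t.
    by rewrite sumEFin lee_fin (bigD1 j)//= lerDl sumr_ge0.
rewrite lte_sum_pinfty// => j _.
by rewrite (le_lt_trans (integral_expR_lin_form_le l j))// ltry.
Qed.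

Lemma integrable_expR_max (l : R) :
  gaussn.-integrable setT (fun t => (expR (l * F t))%:E).
Proof.
apply/integrableP; split => //.
under eq_integral do rewrite gee0_abs ?lee_fin ?expR_ge0//.
exact: integral_expR_max_lty.
Qed.

Lemma integrable_max_lin_form : gaussn.-integrable setT (EFin \o F).
Proof.
apply: (@le_integrable _ _ _ gaussn setT measurableT _
  (fun t => (expR (1 * F t))%:E + (expR (- 1 * F t))%:E)).
- exact/measurable_EFinP.
- move=> t _ /=; rewrite lee_fin mul1r mulN1r.
  by rewrite (le_trans (normr_le_expR _))// ler_norm.
- by apply: integrableD => //; exact: integrable_expR_max.
Qed.

Variable M : R.
Hypothesis EM : \int[gaussn]_t (F t)%:E = M%:E.

(** Jensen's inequality, obtained by integrating the tangent at [- (l * M)]. It removes the second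
    copy of the vector in the symmetrised moment. *)
Lemma integral_expRN_max_ge (l : R) :
  (expR (- (l * M)))%:E <= \int[gaussn]_t (expR (- l * F t))%:E.
Proof.
have mlow : gaussn.-integrable setT (fun t =>
    (expR (- (l * M)) * (1 + l * M))%:E - (expR (- (l * M)) * l)%:E * (F t)%:E).
  apply: integrableB => //; first exact: finite_measure_integrable_cst.
  by apply: integrableZl => //; exact: integrable_max_lin_form.
apply: (@le_trans _ _ (\int[gaussn]_t
    ((expR (- (l * M)) * (1 + l * M))%:E - (expR (- (l * M)) * l)%:E * (F t)%:E))).
  rewrite integralB//; last 2 first.
  - exact: finite_measure_integrable_cst.
  - by apply: integrableZl => //; exact: integrable_max_lin_form.
  rewrite integralZl//; last exact: integrable_max_lin_form.
  rewrite integral_probability_cst EM -EFinM -EFinB lee_fin.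
  by rewrite mulrDr mulr1 mulrA addrK.
apply: le_integral => //; first exact: integrable_expR_max.
move=> t _; rewrite -EFinM -EFinB lee_fin.
rewrite (le_trans _ (expR_tangent (- l * F t) (- (l * M))))//.
by rewrite le_eqVlt; apply/orP; left; apply/eqP; ring.
Qed.

(** [F] dominates one centred form, so [- (l * M) <= l ^+ 2 * v / 2] for every [l > 0]. A negative
    [M] would violate this for small [l]. *)
Lemma mean_max_lin_form_ge0 : (0 <= M)%R.
Proof.
have v0 : (0 <= v)%R.
  by rewrite (le_trans _ (a_le j0))// sumr_ge0// => i _; exact: sqr_ge0.
have H (l : R) : (0 < l)%R -> (- (l * M) <= l ^+ 2 * v / 2)%R.
  move=> l0; rewrite -ler_expR -lee_fin.
  apply: (le_trans (integral_expRN_max_ge l)).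
  rewrite -(sqrrN l) (le_trans _ (integral_expR_lin_form_le (- l) j0))//.
  apply: ge0_le_integral => //.
  by move=> t _; rewrite lee_fin ler_expR ler_nM2l ?oppr_lt0.
rewrite leNgt; apply/negP => M0.
(* With this choice [- (l * M) = l ^+ 2 * (v + 1)], too large for the bound; the added 1 avoids a
   division by zero. *)
pose l := (- M / (v + 1))%R.
have v1 : (0 < v + 1)%R by lra.
have l0 : (0 < l)%R by rewrite divr_gt0// oppr_gt0.
have lv : (l * (v + 1) = - M)%R by rewrite divfK// gt_eqF.
have := H _ l0; nra.
Qed.

Definition gauss_mgf (l : R) : R := fine (\int[gaussn]_t (expR (l * F t))%:E).
Local Notation Lam := gauss_mgf.

Let ELam l : \int[gaussn]_t (expR (l * F t))%:E = (Lam l)%:E.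
Proof. by rewrite fineK//; exact: integrable_fin_num (integrable_expR_max l). Qed.

Let Lam_gt0 l : (0 < Lam l)%R.
Proof.
rewrite -lte_fin -ELam -[l]opprK (lt_le_trans _ (integral_expRN_max_ge (- l)))//.
by rewrite lte_fin expR_gt0.
Qed.

(** Jensen's inequality for the concave power [b]: after dividing by [expR psi = Lam l], the
    variable has mean 1 and [expR_convex] applies pointwise. *)
Lemma integral_expR_max_subunit (b l : R) : (0 <= b)%R -> (b <= 1)%R ->
  \int[gaussn]_t (expR (b * (l * F t)))%:E <= (expR (b * ln (Lam l)))%:E.
Proof.
move=> b0 b1; set psi := ln (Lam l).
have Epsi : expR psi = Lam l by rewrite lnK// posrE.
pose k : R := (expR (b * psi) * (b / Lam l))%R.
have k0 : (0 <= k)%R by rewrite mulr_ge0 ?expR_ge0// divr_ge0// ltW.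
have c0 : (0 <= expR (b * psi) * (1 - b))%R by rewrite mulr_ge0 ?expR_ge0// subr_ge0.
apply: (@le_trans _ _ (\int[gaussn]_t
    (k%:E * (expR (l * F t))%:E + (expR (b * psi) * (1 - b))%:E))).
  apply: ge0_le_integral => //.
  - apply/measurable_EFinP; apply: measurableT_comp => //.
    by do 2 apply: measurable_funM => //.
  - by apply: emeasurable_funD => //; exact: emeasurable_funM.
  - move=> t _; rewrite -EFinM -EFinD lee_fin.
    have -> : (b * (l * F t) = b * psi + b * (l * F t - psi))%R by ring.
    rewrite expRD /k -mulrA -mulrDr ler_wpM2l ?expR_ge0//.
    rewrite (le_trans (expR_convex _ b0 b1))//.
    by rewrite expRD expRN Epsi mulrAC mulrA.
rewrite ge0_integralD//; last 2 first.
- by move=> t _; rewrite -EFinM lee_fin mulr_ge0// expR_ge0.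
- exact: emeasurable_funM.
rewrite ge0_integralZl// integral_probability_cst ELam -EFinM -EFinD lee_fin.
rewrite /k -mulrA divfK ?gt_eqF// -mulrDr.
by rewrite (addrC b) subrK mulr1.
Qed.

Section Rotation30.
Variable c : R.
Hypothesis c2 : (c ^+ 2 = 3 / 4)%R.

Let rot30 := @tuple_rot R c 2^-1 n.

Let rot30_cycle z : (rot30 (rot30 (rot30 z))).1 = z.2.
Proof.
apply: eq_from_tnth => i; rewrite /rot30 /tuple_rot; do !rewrite tnth_mktuple /=.
apply/eqP; rewrite -subr_eq0; apply/eqP.
(* Three turns of 30 degrees make a quarter turn; the triple-angle polynomials differ from it by a
   multiple of [c ^+ 2 - 3 / 4]. *)
transitivity ((c ^+ 2 - 3 / 4) * (c * tnth z.1 i + 3 / 2 * tnth z.2 i))%R.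
  by field.
by rewrite c2 subrr mul0r.
Qed.

Let c1 : (c <= 1)%R.
Proof. by rewrite leNgt; apply/negP => c1; move: c2; nra. Qed.

Let mFst : measurable_fun setT (fun z : n.-tuple R * n.-tuple R => F z.1).
Proof. exact: (measurableT_comp mF measurable_fst). Qed.

Let mFrot : measurable_fun setT (fun z => F (rot30 z).1).
Proof. exact: (measurableT_comp mFst (@measurable_tuple_rot _ c 2^-1 n)). Qed.

(* Only the argmax at [x] is used, which makes the increment linear in [y]. *)
Lemma integral_expR_increment_le (l : R) : (0 <= l)%R ->
  \int[gaussn \x gaussn]_z (expR (3 * (l * (F z.1 - F (rot30 z).1))))%:E <=
  (expR (9 * l ^+ 2 * v / 8))%:E *
  \int[gaussn]_t (expR (3 * (1 - c) * (l * F t)))%:E.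
Proof.
move=> l0.
have mh : measurable_fun setT
    (fun z => (expR (3 * (l * (F z.1 - F (rot30 z).1))))%:E : \bar R).
  apply/measurable_EFinP; apply: measurableT_comp => //.
  by do 2 apply: measurable_funM => //; exact: measurable_funB.
rewrite fubini_tonelli1// -ge0_integralZl//; last first.
  apply/measurable_EFinP; apply: measurableT_comp => //.
  by do 2 apply: measurable_funM => //.
apply: ge0_le_integral => //.
- by move=> x _; exact: integral_ge0.
- by apply: (measurable_fun_fubini_tonelli_F (m2 := gaussn)
    (fun z => (expR (3 * (l * (F z.1 - F (rot30 z).1))))%:E)).
- apply: emeasurable_funM => //.
  apply/measurable_EFinP; apply: measurableT_comp => //.
  by do 2 apply: measurable_funM => //.
move=> x _; have [j Fx] := F_att x.
have linrot y : lin_form (a j) (rot30 (x, y)).1 =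
    (c * F x + 2^-1 * lin_form (a j) y)%R.
  rewrite Fx /lin_form !mulr_sumr -big_split; apply: eq_bigr => i _.
  by rewrite /rot30 /tuple_rot tnth_mktuple/=; ring.
apply: (@le_trans _ _ (\int[gaussn]_y ((expR (3 * (1 - c) * (l * F x)))%:E *
    (expR (- (3 / 2 * l) * lin_form (a j) y))%:E))).
  apply: ge0_le_integral => //.
  - exact: (measurableT_comp mh (pair1_measurable x)).
  - exact: emeasurable_funM.
  - move=> y _; rewrite -EFinM lee_fin -expRD ler_expR/=.
    have := F_ub (rot30 (x, y)).1 j; rewrite linrot => H.
    have : (0 <= l * (F (rot30 (x, y)).1 - (c * F x + 2^-1 * lin_form (a j) y)))%R.
      by rewrite mulr_ge0// subr_ge0.
    by move: (F _) (lin_form _ _) => A B; lra.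
rewrite ge0_integralZl// muleC; apply: lee_wpmul2r; first by rewrite lee_fin expR_ge0.
(* The parameter [3 / 2 * l] contributes [(3 / 2 * l) ^+ 2 * v / 2 = 9 * l ^+ 2 * v / 8]. *)
rewrite (le_trans (integral_expR_lin_form_le _ _))// lee_fin ler_expR.
by rewrite le_eqVlt; apply/orP; left; apply/eqP; field.
Qed.

(** With [psi = ln (Lam l)], the moment of [l * (F x - F y)] is at least [expR (psi - l * M)] by
    independence, and at most the moment of one tripled increment. The latter returns
    [3 * (1 - c) * psi], which moves to the left. *)
Lemma max_lin_form_mgf (l : R) : (0 <= l)%R -> (3 * (1 - c) < 1)%R ->
  ((1 - 3 * (1 - c)) * ln (Lam l) <= l * M + 9 * l ^+ 2 * v / 8)%R.
Proof.
move=> l0 c31.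
pose h z := (expR (3 * (l * (F z.1 - F (rot30 z).1))))%:E : \bar R.
have mh : measurable_fun setT h.
  apply/measurable_EFinP; apply: measurableT_comp => //.
  by do 2 apply: measurable_funM => //; exact: measurable_funB.
have h0 z : 0 <= h z by rewrite lee_fin expR_ge0.
have mrot := @measurable_tuple_rot _ c 2^-1 n.
have mh1 : measurable_fun setT (fun z => h (rot30 z)) by exact: measurableT_comp.
have mh2 : measurable_fun setT (fun z => h (rot30 (rot30 z))).
  exact: (measurableT_comp mh1 mrot).
have mh012 := emeasurable_funD (emeasurable_funD mh mh1) mh2.
have cs : (c ^+ 2 + 2^-1 ^+ 2 = 1 :> R)%R by rewrite c2; field.
have s0 : (2^-1 != 0 :> R)%R by [].
have Eh1 : \int[gaussn \x gaussn]_z h (rot30 z) = \int[gaussn \x gaussn]_z h z.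
  exact: integral_gauss_vect_rot.
have Eh2 : \int[gaussn \x gaussn]_z h (rot30 (rot30 z)) = \int[gaussn \x gaussn]_z h z.
  by rewrite -Eh1; exact: (integral_gauss_vect_rot cs s0 mh1 (fun z => h0 _)).
have mdiff : measurable_fun setT (fun z : n.-tuple R * n.-tuple R =>
    (expR (l * F z.1))%:E * (expR (- l * F z.2))%:E : \bar R).
  apply: emeasurable_funM.
  - exact: (measurableT_comp (mexpF l) measurable_fst).
  - exact: (measurableT_comp (mexpF (- l)) measurable_snd).
have E1 : \int[gaussn \x gaussn]_z
    ((expR (l * F z.1))%:E * (expR (- l * F z.2))%:E) =
    (Lam l)%:E * (Lam (- l))%:E.
  have := @ge0_integral_prod_mul _ _ _ _ _ gaussn gaussn _ _ (mexpF l) (mexpF (- l)).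
  by rewrite !ELam; apply => t; rewrite lee_fin expR_ge0.
have E2 : \int[gaussn \x gaussn]_z
    ((expR (l * F z.1))%:E * (expR (- l * F z.2))%:E) <=
    \int[gaussn \x gaussn]_z h z.
  rewrite -(ge0_integral_mean3 mh mh1 mh2 h0 (fun z => h0 _) (fun z => h0 _) Eh1 Eh2).
  apply: ge0_le_integral => //.
  - exact: (emeasurable_funM (measurable_cst _) mh012).
  - move=> z _; rewrite -EFinM -expRD /h -!EFinD -EFinM lee_fin.
    (* The three increments along the orbit telescope to [F z.1 - F z.2], by [rot30_cycle]. *)
    apply: le_trans (expR_mean3 _ _ _).
    rewrite ler_expR le_eqVlt; apply/orP; left; apply/eqP.
    by rewrite rot30_cycle; ring.
have c3 : (0 <= 3 * (1 - c))%R by apply: mulr_ge0; rewrite ?subr_ge0.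
have E3 := le_trans E2 (integral_expR_increment_le l0).
have {}E3 : (Lam l * Lam (- l) <=
    expR (9 * l ^+ 2 * v / 8) * expR (3 * (1 - c) * ln (Lam l)))%R.
  rewrite -lee_fin EFinM -E1; apply: (le_trans E3); rewrite EFinM.
  apply: lee_wpmul2l; first by rewrite lee_fin expR_ge0.
  exact: (integral_expR_max_subunit l c3 (ltW c31)).
have E4 : (expR (- (l * M)) <= Lam (- l))%R.
  by rewrite -lee_fin -ELam integral_expRN_max_ge.
have : (expR (ln (Lam l)) * expR (- (l * M)) <=
    expR (9 * l ^+ 2 * v / 8) * expR (3 * (1 - c) * ln (Lam l)))%R.
  have -> : expR (ln (Lam l)) = Lam l by apply: lnK; rewrite posrE; exact: Lam_gt0.
  by apply: le_trans E3; apply: ler_wpM2l E4; exact: ltW (Lam_gt0 l).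
rewrite -!expRD ler_expR; move: (ln _) => psi H; lra.
Qed.

End Rotation30.

Lemma integral_expR_max_le (l : R) : (0 <= l)%R ->
  \int[gaussn]_t (expR (l * F t))%:E <=
  (expR (7 / 4 * (l * M) + 63 / 32 * (l ^+ 2 * v)))%:E.
Proof.
move=> l0; pose c : R := Num.sqrt (3 / 4).
have c2 : (c ^+ 2 = 3 / 4)%R by rewrite sqr_sqrtr// divr_ge0.
have c0 : (0 <= c)%R by exact: sqrtr_ge0.
(* This rational bound gives [1 - 3 * (1 - c) > 4 / 7]; dividing by [4 / 7] produces the constants
   [7 / 4] and [7 / 4 * 9 / 8 = 63 / 32]. *)
have c67 : (6 / 7 < c)%R by rewrite ltNge; apply/negP => ?; move: c2; nra.
have v0 : (0 <= v)%R.
  by rewrite (le_trans _ (a_le j0))// sumr_ge0// => i _; exact: sqr_ge0.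
have := max_lin_form_mgf c2 l0; rewrite ELam lee_fin.
have -> : Lam l = expR (ln (Lam l)) by rewrite lnK// posrE; exact: Lam_gt0.
rewrite expRK ler_expR; move: (ln _) => psi H.
have {}H := H (_ : _); have : (3 * (1 - c) < 1)%R by lra.
move=> /H {}H.
have lM : (0 <= l * M)%R by rewrite mulr_ge0// mean_max_lin_form_ge0.
have lv : (0 <= l ^+ 2 * v)%R by rewrite mulr_ge0// sqr_ge0.
(* For [psi <= 0] the right-hand side is already nonnegative, because [M] is. *)
have [psi0|psi0] := leP psi 0%R; first by lra.
have : (4 / 7 * psi <= (1 - 3 * (1 - c)) * psi)%R by rewrite ler_pM2r//; lra.
move: H; have -> : (9 * l ^+ 2 * v / 8 = 9 / 8 * (l ^+ 2 * v))%R by ring.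
move: (_ * psi)%R => k A B; lra.
Qed.

End MaxLinearForms.

(** * Subset sums as linear forms, and their maximum over a class *)

Section SubsetSums.
Context {R : realType} (n : nat).
Implicit Types (S T : {set 'I_n}) (A : {set {set 'I_n}}) (t : n.-tuple R).

Definition subset_ind S (i : 'I_n) : R := (i \in S)%:R.

Definition row_of_tuple t : 'rV[R]_n := \row_i tnth t i.

Lemma subset_sumE S t : subset_sum S (row_of_tuple t) = lin_form (subset_ind S) t.
Proof.
rewrite /subset_sum /lin_form big_mkcond; apply: eq_bigr => i _.
by rewrite /subset_ind mxE; case: ifP => _; rewrite ?mul1r ?mul0r.
Qed.

Lemma random_vectorE d (Omega : measurableType d) (P : probability Omega R)
    (X : 'I_n -> {RV P >-> R}) w : random_vector X w = row_of_tuple (rv_tuple X w).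
Proof. by apply/rowP => i; rewrite !mxE tnth_mktuple. Qed.

Lemma sum_subset_ind_sqr S : \sum_i subset_ind S i ^+ 2 = #|S|%:R.
Proof.
rewrite -sum1_card natr_sum [RHS]big_mkcond; apply: eq_bigr => i _.
by rewrite /subset_ind; case: ifP => _; rewrite ?expr1n ?expr0n.
Qed.

Definition max_tuple A t : R := max_subset_sum A (row_of_tuple t).

(** Nonemptiness makes the extended maximum one of the finite sums, so [fine] does not alter it. *)
Lemma max_subset_sum_attained A t : A != finset.set0 ->
  (forall S, S \in A -> subset_sum S (row_of_tuple t) <= max_tuple A t) /\
  exists2 S, S \in A & max_tuple A t = subset_sum S (row_of_tuple t).
Proof.
move=> /set0Pn[S0 S0A].
have [S SA E] : exists2 S, S \in A &
    (\big[maxe/-oo]_(T in A) (subset_sum T (row_of_tuple t))%:E =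
    (subset_sum S (row_of_tuple t))%:E)%E.
  have := @eq_bigmax _ _ _ -oo%E S0 (mem A)
    (fun T => (subset_sum T (row_of_tuple t))%:E) S0A.
  by case=> [T _|S SA ->]; [exact: leNye|exists S].
have EF : max_tuple A t = subset_sum S (row_of_tuple t).
  by rewrite /max_tuple /max_subset_sum E.
split; last by exists S.
move=> T TA; rewrite EF -lee_fin -E.
exact: (le_bigmax_cond _ (fun T => (subset_sum T (row_of_tuple t))%:E)).
Qed.

Lemma measurable_max_tuple A : measurable_fun setT (max_tuple A).
Proof.
apply: (measurableT_comp (f := fine)) => //.
elim: (index_enum _) => [|S s IH].
  by rewrite (_ : (fun _ => _) = cst -oo%E)//; apply/funext => t; rewrite big_nil.
rewrite (_ : (fun t : n.-tuple R => _) = fun t : n.-tuple R => if S \in A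
    then maxe (lin_form (subset_ind S) t)%:E
      (\big[maxe/-oo%E]_(T <- s | T \in A) (subset_sum T (row_of_tuple t))%:E)
    else \big[maxe/-oo%E]_(T <- s | T \in A) (subset_sum T (row_of_tuple t))%:E).
  case: (S \in A) => //; apply: measurable_maxe => //.
  by apply/measurable_EFinP; exact: measurable_lin_form.
by apply/funext => t; rewrite big_cons subset_sumE.
Qed.

End SubsetSums.

(** * From closeness in the metric to large overlap *)

Section CoverOverlap.
Context {R : realType}.

Lemma sqr_le_expR (x : R) : x ^+ 2 <= 4 * (expR x + expR (- x)).
Proof.
have H (y : R) : 0 <= y -> y ^+ 2 <= 4 * expR y.
  move=> y0; have -> : expR y = expR (y / 2) ^+ 2.
    by rewrite -expRM_natl mulrC divfK.
  have := expR_ge1Dx (y / 2); have := expR_ge0 (y / 2); nra.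
have := expR_ge0 x; have := expR_ge0 (- x).
case: (ger0P x) => x0.
  by have := H _ x0; lra.
by have := H (- x); rewrite sqrrN => /(_ (ltW _)); rewrite oppr_gt0 => /(_ x0); lra.
Qed.

(** Finiteness matters because [fine] in [L2_dist] would send an infinite second moment to 0 and
    make the distance bound empty. *)
Lemma integral_gauss_vect_sqr_lty n (a : 'I_n -> R) :
  (\int[gauss_vect n]_t (lin_form a t ^+ 2)%:E < +oo)%E.
Proof.
have mexp l : measurable_fun setT
    (fun t : n.-tuple R => (expR (lin_form (fun i => l * a i) t))%:E).
  by apply/measurable_EFinP/measurableT_comp => //; exact: measurable_lin_form.
apply: (@le_lt_trans _ _ (\int[gauss_vect n]_t (4%:E *
    ((expR (lin_form (fun i => 1 * a i) t))%:E +
     (expR (lin_form (fun i => (- 1) * a i) t))%:E)))%E).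
  apply: ge0_le_integral => //.
  - by move=> t _; rewrite lee_fin sqr_ge0.
  - by apply/measurable_EFinP/measurable_funX; exact: measurable_lin_form.
  - by apply: emeasurable_funM => //; exact: emeasurable_funD.
  - move=> t _; rewrite !lin_formZ mul1r mulN1r -EFinD -EFinM lee_fin.
    exact: sqr_le_expR.
rewrite ge0_integralZl//;
  [|exact: emeasurable_funD|by move=> t _; rewrite adde_ge0// lee_fin expR_ge0].
by rewrite ge0_integralD// !integral_gauss_vect_expR -EFinD -EFinM ltry.
Qed.

(** The squared distance dominates the sum of squared differences of indicators, [2 * K] minus twice
    the overlap. Being at most [K / 4], it forces an overlap of at least [7 / 8 * K]. *)
Lemma L2_dist_overlap d (Omega : measurableType d) (P : probability Omega R)
    (n : nat) (X : 'I_n -> {RV P >-> R}) (K : nat) (S T : {set 'I_n}) :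
  iid_standard_normal X -> #|S| = K -> #|T| = K ->
  L2_dist X S T <= Num.sqrt K%:R / 2 ->
  7 / 8 * K%:R <= \sum_i subset_ind S i * subset_ind T i :> R.
Proof.
move=> iidX SK TK.
pose b i := subset_ind S i - subset_ind T i : R.
have E2 : ('E_P[(fun w => (subset_sum S (random_vector X w)
    - subset_sum T (random_vector X w)) ^+ 2)%R] =
    \int[gauss_vect n]_t (lin_form b t ^+ 2)%:E)%E.
  rewrite unlock -(ge0_integral_rv_tuple iidX)//.
  - apply: eq_integral => w _; rewrite random_vectorE !subset_sumE /lin_form -sumrB.
    by under eq_bigr do rewrite -mulrBl.
  - by apply/measurable_EFinP/measurable_funX; exact: measurable_lin_form.
  - by move=> t; rewrite lee_fin sqr_ge0.
have fin2 : (\int[gauss_vect n]_t (lin_form b t ^+ 2)%:E)%E \is a fin_num.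
  rewrite ge0_fin_numE; first exact: integral_gauss_vect_sqr_lty.
  by apply: integral_ge0 => t _; rewrite lee_fin sqr_ge0.
have low : \sum_i b i ^+ 2 <= fine (\int[gauss_vect n]_t (lin_form b t ^+ 2)%:E)%E.
  have := integral_gauss_vect_sqr_ge b 0.
  under eq_integral do rewrite add0r.
  by rewrite expr0n/= add0r -{1}(fineK fin2) lee_fin.
rewrite /L2_dist E2; move: low; move: (fine _) => z low.
have z0 : 0 <= z by apply: le_trans low; apply: sumr_ge0 => i _; exact: sqr_ge0.
move=> zK; have {}zK : z <= K%:R / 4.
  have : Num.sqrt z ^+ 2 <= (Num.sqrt K%:R / 2) ^+ 2 :> R.
    by rewrite lerXn2r// nnegrE ?divr_ge0 ?sqrtr_ge0.
  by rewrite sqr_sqrtr// expr_div_n sqr_sqrtr//; lra.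
have : \sum_i b i ^+ 2 = K%:R + K%:R - 2 * \sum_i subset_ind S i * subset_ind T i.
  rewrite -{1}SK -TK -!sum_subset_ind_sqr -big_split mulr_sumr -sumrB.
  by apply: eq_bigr => i _; rewrite /b/=; ring.
by move: (\sum_i b i ^+ 2) low => B; lra.
Qed.

End CoverOverlap.

(** * Bounding the type I error by splitting at a threshold for the maximum *)

Theorem proposition7p1 (R : realType) (d : measure_display)
    (Omega : measurableType d) (P : probability Omega R)
    (n : nat) (X : 'I_n -> {RV P >-> R}) (hX : iid_standard_normal X)
    (K : nat) (hK : (1 <= K)%N)
    (C : {set {set 'I_n}}) (hC : (1 <= #|C|)%N)
    (hCK : forall S : {set 'I_n}, S \in C -> #|S| = K)
    (A : {set {set 'I_n}}) (hA : is_cover X (Num.sqrt K%:R / 2) A C)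
    (mu : R) (hmu : 0 < mu)
    (delta : R) (hdelta0 : 0 < delta) (hdelta1 : delta < 1)
    (hmu_large :
      ((2 / K%:R)%:E * 'E_P[fun w => max_subset_sum A (random_vector X w)]
        + (Num.sqrt (32 * ln (2 / delta) / K%:R))%:E <= mu%:E)%E) :
  (P [set w | optimal_test C K mu (random_vector X w) = 1%R] <= delta%:E)%E.
Proof.
have [AC cov] := hA.
have iidX := hX.
have [S0 S0C] : exists S, S \in C by apply/set0Pn; rewrite -card_gt0.
have A0 : A != finset.set0.
  by have [T TA _] := cov S0 S0C; apply/set0Pn; exists T.
pose F := @max_tuple R n A.
have mF : measurable_fun setT F by exact: measurable_max_tuple.
have Fub t S : S \in A -> lin_form (subset_ind S) t <= F t.
  by rewrite -subset_sumE; exact: (max_subset_sum_attained t A0).1.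
pose a (j : {S : {set 'I_n} | S \in A}) : 'I_n -> R := subset_ind (val j).
have a_le j : \sum_i a j i ^+ 2 <= K%:R.
  by rewrite sum_subset_ind_sqr (hCK _ (fintype.subsetP AC _ (valP j))).
have F_ub t j : lin_form (a j) t <= F t by apply: Fub; exact: valP.
have F_att t : exists j, F t = lin_form (a j) t.
  have [_ [S SA E]] := max_subset_sum_attained t A0.
  by exists (exist _ S SA); rewrite /F E subset_sumE.
pose M := fine (\int[gauss_vect n]_t (F t)%:E)%E.
have EM : (\int[gauss_vect n]_t (F t)%:E = M%:E)%E.
  rewrite fineK//; apply: integrable_fin_num => //.
  exact: (integrable_max_lin_form mF a_le F_att).
have {}hmu_large : 2 / K%:R * M + Num.sqrt (32 * ln (2 / delta) / K%:R) <= mu.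
  rewrite -lee_fin; apply: le_trans hmu_large; rewrite EFinD EFinM -EM unlock.
  rewrite -(integral_rv_tuple iidX); last exact/measurable_EFinP.
  rewrite le_eqVlt; apply/orP; left; apply/eqP; congr (_ * _ + _)%E.
  by apply: eq_integral => w _; rewrite random_vectorE.
have k0 : 0 < K%:R :> R by rewrite ltr0n.
move: hmu_large; set ell := ln (2 / delta).
have ell0 : 0 < ell by rewrite ln_gt0// ltr_pdivlMr//; lra.
have expell : expR (- ell) = delta / 2.
  by rewrite expRN lnK ?posrE ?divr_gt0// invf_div.
pose s := Num.sqrt (2 * K%:R * ell).
have s0 : 0 < s by rewrite sqrtr_gt0 !mulr_gt0.
have s2 : s ^+ 2 = 2 * K%:R * ell by rewrite sqr_sqrtr// !mulr_ge0// ltW.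
have -> : Num.sqrt (32 * ell / K%:R) = 4 * s / K%:R.
  have -> : 32 * ell / K%:R = (4 * s / K%:R) ^+ 2.
    by rewrite !exprMn s2 exprVn; field; rewrite gt_eqF.
  by rewrite sqrtr_sqr ger0_norm// divr_ge0// ?mulr_ge0// ltW.
move=> hmu_large.
have {}hmu_large : 2 * M + 4 * s <= K%:R * mu.
  rewrite -(ler_pM2l k0) in hmu_large; apply: le_trans hmu_large.
  by rewrite le_eqVlt; apply/orP; left; apply/eqP; field; rewrite gt_eqF.
pose t0 := 7 / 8 * (K%:R * mu) - s.
have t0_ge : 7 / 4 * M + 5 / 2 * s <= t0 by rewrite /t0; lra.
(* [p] picks a nearby member of the cover. Choice needs a total function, so the value outside [C]
   is an arbitrary [S0]. *)
have /choice[p pP] S : exists T, S \in C -> T \in A /\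
    7 / 8 * K%:R <= \sum_i subset_ind S i * subset_ind T i :> R.
  have [SC|SC] := boolP (S \in C); last by exists S0.
  have [T TA ST] := cov S SC; exists T => _; split => //.
  have TC := fintype.subsetP AC _ TA.
  exact: (L2_dist_overlap iidX (hCK _ SC) (hCK _ TC) ST).
(* [l2] is the optimal Chernoff parameter for an [s]-deviation of a Gaussian of variance [K], with
   exponent [- s ^+ 2 / (2 * K) = - ell]. [l1] is half of it, to suit the weaker moment bound for
   [F]. *)
pose l1 := s / (2 * K%:R); pose l2 := s / K%:R.
have l10 : 0 <= l1 by rewrite divr_ge0 ?mulr_ge0 ?ltW.
have l20 : 0 <= l2 by rewrite divr_ge0 ?ltW.
pose L (t : n.-tuple R) := likelihood_ratio C K mu (row_of_tuple t).
pose g S (t : n.-tuple R) := expR (l2 * t0 - K%:R * mu ^+ 2 / 2) *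
  expR (lin_form (fun i => mu * subset_ind S i - l2 * subset_ind (p S) i) t).
have mg S : measurable_fun setT (g S).
  apply: measurable_funM => //; apply: measurableT_comp => //.
  exact: measurable_lin_form.
have g0 S t : 0 <= g S t by rewrite mulr_ge0 ?expR_ge0.
(* Where [F] stays below [t0], the weight [expR (l2 * (t0 - X_(p S)))] is at
   least 1 and tilts the likelihood ratio towards the event [X_(p S) < t0]. *)
have gL S t : S \in C -> F t < t0 ->
    expR (mu * lin_form (subset_ind S) t - K%:R * mu ^+ 2 / 2) <= g S t.
  move=> SC Ft; have [pA _] := pP S SC.
  rewrite /g -expRD ler_expR.
  have -> : lin_form (fun i => mu * subset_ind S i - l2 * subset_ind (p S) i) t =
      mu * lin_form (subset_ind S) t - l2 * lin_form (subset_ind (p S)) t.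
    rewrite /lin_form !mulr_sumr -sumrB; apply: eq_bigr => i _.
    by rewrite mulrBl !mulrA.
  have : 0 <= l2 * (t0 - lin_form (subset_ind (p S)) t).
    by rewrite mulr_ge0// subr_ge0 (le_trans (Fub _ _ pA))// ltW.
  lra.
have Eg S : S \in C -> (\int[gauss_vect n]_t (g S t)%:E <= (delta / 2)%:E)%E.
  move=> SC; have [pA ov] := pP S SC; have pC := fintype.subsetP AC _ pA.
  under eq_integral do rewrite EFinM.
  rewrite ge0_integralZl//; last first.
    apply/measurable_EFinP; apply: measurableT_comp => //.
    exact: measurable_lin_form.
  rewrite integral_gauss_vect_expR -EFinM lee_fin -expRD -expell ler_expR.
  have -> : \sum_i (mu * subset_ind S i - l2 * subset_ind (p S) i) ^+ 2 =
      mu ^+ 2 * K%:R - 2 * (mu * l2) * (\sum_i subset_ind S i * subset_ind (p S) i)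
      + l2 ^+ 2 * K%:R.
    rewrite -{1}(hCK _ SC) -(hCK _ pC) -!sum_subset_ind_sqr !mulr_sumr -sumrB -big_split.
    by apply: eq_bigr => i _ /=; ring.
  (* The cross term is [- mu * l2] times the overlap; replacing the overlap by [7 / 8 * K] leaves
     the exponent at most [- l2 * s + l2 ^+ 2 * K / 2 = - ell]. *)
  have : 0 <= mu * l2 * ((\sum_i subset_ind S i * subset_ind (p S) i) - 7 / 8 * K%:R).
    by rewrite mulr_ge0 ?subr_ge0// mulr_ge0// ltW.
  move: (\sum_i _) ov => q ov.
  have -> : ell = s ^+ 2 / (2 * K%:R) by rewrite s2; field; rewrite gt_eqF.
  have -> : s = l2 * K%:R by rewrite /l2 divfK// gt_eqF.
  have -> : (l2 * K%:R) ^+ 2 / (2 * K%:R) = l2 ^+ 2 * K%:R / 2.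
    by field; rewrite gt_eqF.
  rewrite /t0 (_ : s = l2 * K%:R); last by rewrite /l2 divfK// gt_eqF.
  lra.
have mexpF : measurable_fun setT (fun t => (expR (l1 * F t))%:E).
  by apply/measurable_EFinP; apply: measurableT_comp => //; exact: measurable_funM.
have EF : (\int[gauss_vect n]_t (expR (- (l1 * t0)) * expR (l1 * F t))%:E <=
    (delta / 2)%:E)%E.
  under eq_integral do rewrite EFinM.
  rewrite ge0_integralZl//.
  apply: (@le_trans _ _ ((expR (- (l1 * t0)))%:E *
      (expR (7 / 4 * (l1 * M) + 63 / 32 * (l1 ^+ 2 * K%:R)))%:E)%E).
    apply: lee_wpmul2l; first by rewrite lee_fin expR_ge0.
    exact: (integral_expR_max_le mF a_le F_ub F_att EM l10).
  rewrite -EFinM lee_fin -expRD -expell ler_expR.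
  (* In units of [l1 ^+ 2 * K], the exponent is at most [- 5 + 63 / 32], while the target [- ell] is
     only [- 2]. *)
  have -> : ell = 2 * (l1 ^+ 2 * K%:R).
    have -> : ell = s ^+ 2 / (2 * K%:R) by rewrite s2; field; rewrite gt_eqF.
    by rewrite /l1; field; rewrite gt_eqF.
  have l1s : l1 * s = 2 * (l1 ^+ 2 * K%:R) by rewrite /l1; field; rewrite gt_eqF.
  have : 0 <= l1 * (t0 - (7 / 4 * M + 5 / 2 * s)) by rewrite mulr_ge0// subr_ge0.
  have : 0 <= l1 ^+ 2 * K%:R by rewrite mulr_ge0// sqr_ge0.
  have -> : l1 * (t0 - (7 / 4 * M + 5 / 2 * s)) =
      l1 * t0 - 7 / 4 * (l1 * M) - 5 / 2 * (l1 * s) by ring.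
  rewrite l1s; move: (l1 * t0) (l1 * M) (l1 ^+ 2 * K%:R) => x y z; lra.
have mL : measurable_fun setT L.
  apply: measurable_funM => //.
  rewrite (_ : (fun t => _) = fun t : n.-tuple R => \sum_(S <- enum C)
      expR (mu * lin_form (subset_ind S) t - K%:R * mu ^+ 2 / 2)); last first.
    by apply/funext => t; rewrite big_enum; apply: eq_bigr => S _; rewrite subset_sumE.
  apply: measurable_sum => S; apply: measurableT_comp => //.
  by apply: measurable_funB => //; apply: measurable_funM => //; exact: measurable_lin_form.
pose B := [set t : n.-tuple R | 1 < L t].
have mB : measurable B.
  rewrite (_ : B = setT `&` L @^-1` `]1, +oo[%classic); first exact: mL.
  by apply/seteqP; split => t /=; rewrite in_itv/= andbT => // -[].
have -> : [set w | optimal_test C K mu (random_vector X w) = 1%R] =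
    rv_tuple X @^-1` B.
  apply/seteqP; split => w /=; rewrite /optimal_test indicE random_vectorE.
    have [+ _|_ /eqP] := boolP (_ \in _); last by rewrite eq_sym oner_eq0.
    by rewrite inE.
  by move=> Bw; rewrite mem_set.
have N0 : 0 < #|C|%:R :> R by rewrite ltr0n.
pose G (t : n.-tuple R) := #|C|%:R^-1 * \sum_(S <- enum C) g S t.
have mG : measurable_fun setT G by apply: measurable_funM => //; exact: measurable_sum.
have G0 t : 0 <= G t by rewrite mulr_ge0 ?invr_ge0 ?sumr_ge0// ltW.
have EG : (\int[gauss_vect n]_t (G t)%:E <= (delta / 2)%:E)%E.
  have mgE S : measurable_fun setT (fun t => (g S t)%:E) by exact/measurable_EFinP.
  rewrite /G; under eq_integral do rewrite EFinM.
  rewrite ge0_integralZl//; last 2 first.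
  - by apply/measurable_EFinP; exact: measurable_sum.
  - by move=> t _; rewrite lee_fin sumr_ge0.
  under eq_integral do rewrite -sumEFin.
  rewrite ge0_integral_sum//; last by move=> S t _; rewrite lee_fin.
  apply: (@le_trans _ _ ((#|C|%:R^-1)%:E * \sum_(S <- enum C) (delta / 2)%:E)%E).
    apply: lee_wpmul2l; first by rewrite lee_fin invr_ge0 ltW.
    rewrite big_seq [leRHS]big_seq; apply: lee_sum => S; rewrite mem_enum; exact: Eg.
  rewrite sumEFin -EFinM lee_fin big_enum sumr_const.
  rewrite -[X in _ * X <= _]mulr_natl mulrA mulVf ?mul1r//.
  by rewrite gt_eqF.
rewrite (rv_tuple_law iidX mB) -[B]setIT -integral_indic//.
(* On [B], the first term is at least 1 when [t0 <= F t]; otherwise [1 < L t <= G t], by [gL]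
   averaged over [C]. *)
apply: (@le_trans _ _ (\int[gauss_vect n]_t
    ((expR (- (l1 * t0)) * expR (l1 * F t))%:E + (G t)%:E))%E).
  apply: ge0_le_integral => //.
  - by apply/measurable_EFinP; exact: measurable_indic.
  - apply/measurable_EFinP; apply: measurable_funD => //.
    by apply: measurable_funM => //; exact/measurable_EFinP.
  - move=> t _; rewrite -EFinD lee_fin indicE.
    have [|_] := boolP (t \in B); last by rewrite addr_ge0// mulr_ge0// expR_ge0.
    rewrite inE /B /= => L1; rewrite -expRD.
    have [Ft|Ft] := leP t0 (F t).
      rewrite -[leLHS]addr0 lerD// -[leLHS]expR0 ler_expR addrC subr_ge0.
      by rewrite ler_wpM2l.
    rewrite -[leLHS]add0r lerD ?expR_ge0// (le_trans (ltW L1))//.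
    apply: ler_wpM2l; first by rewrite invr_ge0 ltW.
    by rewrite big_enum; apply: ler_sum => S SC; rewrite subset_sumE gL.
rewrite ge0_integralD//.
- by rewrite [delta]splitr EFinD leeD.
- by apply/measurable_EFinP; apply: measurable_funM => //; exact/measurable_EFinP.
- by move=> t _; rewrite lee_fin.
- exact/measurable_EFinP.
Qed.
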